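(* Let $(r,s)=(n-2,2)$, and fix distinct indices $1\le i_1,i_2\le n$. Then the $\mathcal G$-translates of the affine chart ${}_1\mathcal U_{n-2,2}$ cover the splitting model $\mathrm M^{\rm spl}$.
   Context: Setting: $F_0$ complete discretely valued with ring of integers $O_{F_0}$, uniformizer $\pi_0$, perfect residue field $k$ of characteristic $\neq2$; $F/F_0$ ramified quadratic with ring of integers $O_F$, uniformizer $\pi$, $\pi^2=\pi_0$. $V$ an $F$-vector space of dimension $n=2m>3$ with split $F/F_0$-hermitian form $\phi$ ($\phi(e_i,e_{n+1-j})=\delta_{ij}$), $(x,y)=\frac12\mathrm{Tr}_{F/F_0}\phi(x,y)$. $\Lambda_m=\mathrm{span}_{O_F}\{\pi^{-1}e_1,\dots,\pi^{-1}e_m,e_{m+1},\dots,e_n\}$, $t$ = multiplication by $\pi$. Signature $(r,s)$, $r+s=n$, $s\le r$; $E=F_0$ if $r=s$, $E=F$ otherwise, $O=O_E$. $\mathcal M$ is the projective $O_F$-scheme representing $S\mapsto\{(\mathcal F_0,\mathcal F_1)\}$, $\mathcal F_0\subset\mathcal F_1\subset\Lambda_m\otimes_{O_{F_0}}\mathcal O_S$ $\mathcal O_S$-submodules, Zariski locally direct summands of ranks $s,n$, with $\mathcal F_1^\perp=\mathcal F_1$ for $(\,,\,)\otimes\mathcal O_S$, $(t+\pi)\mathcal F_1\subset\mathcal F_0$, $(t-\pi)\mathcal F_0=0$. $\mathrm M^{\rm naive}$ is the $O$-scheme of $t$-stable, totally isotropic, locally direct summands $\mathcal F\subset\Lambda_m\otimes\mathcal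 O_S$ of rank $n$ with $\mathrm{char}_{t|\mathcal F}(X)=(X+\pi)^r(X-\pi)^s$; $\mathrm M^{\rm loc}$ is the scheme-theoretic closure of its generic fiber in it; $\tau:\mathcal M\to\mathrm M^{\rm naive}\otimes_OO_F$, $(\mathcal F_0,\mathcal F_1)\mapsto\mathcal F_1$; $\mathrm M^{\rm spl}=\tau^{-1}(\mathrm M^{\rm loc}\otimes_OO_F)$. $\mathcal G$ is the smooth group scheme over $O_{F_0}$ of automorphisms of the polarized self-dual lattice chain $\{\pi^k\Lambda_m\}_k$ (the parahoric group scheme whose $O_{F_0}$-points form the stabilizer of $\Lambda_m$ in $\mathrm{GU}(V,\phi)$); it acts on $\mathcal M$, $\mathrm M^{\rm spl}$, $\mathrm M^{\rm loc}$. Let $f_1,\dots,f_{2n}$ be the $O_{F_0}$-basis $(\pi^{-1}e_1,\dots,\pi^{-1}e_m,e_{m+1},\dots,e_n,e_1,\dots,e_m,\pi e_{m+1},\dots,\pi e_n)$ of $\Lambda_m$. ${}_1\mathcal U_{n-2,2}$ is the open subscheme of $\mathcal M$ of points such that the projection $\Lambda_m\otimes\mathcal O_S\to\bigoplus_{j=n+1}^{2n}\mathcal O_Sf_j$ (kernel spanned by $f_1,\dots,f_n$) is an isomorphism on $\mathcal F_1$ and $\mathcal F_0\to\mathcal O_S^2$ given by the $f_{n+i_1},f_{n+i_2}$-coordinates is an isomorphism. *)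

(* Defs.v *)
From HB Require Import structures.
From mathcomp Require Import all_boot all_order all_algebra all_field.
From mathcomp Require Import ring zify.

Set Implicit Arguments.
Unset Strict Implicit.
Unset Printing Implicit Defensive.

Import Order.TTheory GRing.Theory Num.Theory.
Local Open Scope ring_scope.

(* Normalized discrete valuations; only the values at nonzero elements are
   meaningful, [dv_zero] fixes the junk value at 0. *)
Record dvaluation (K : fieldType) := DValuation {
  dv :> K -> int;
  dv_zero : dv 0 = 0;
  dv_mul : forall x y, x != 0 -> y != 0 -> dv (x * y) = dv x + dv y;
  dv_add : forall x y, x != 0 -> y != 0 -> x + y != 0 ->
    Num.min (dv x) (dv y) <= dv (x + y);
  dv_onto : exists2 x, x != 0 & dv x = 1
}.

Definition dv_complete (K : fieldType) (v : dvaluation K) : Prop :=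
  forall u : nat -> K,
    (forall N : int, exists k, forall i j, (k <= i)%N -> (k <= j)%N ->
       u i = u j \/ N <= v (u i - u j)) ->
    exists l, forall N : int, exists k, forall i, (k <= i)%N ->
       u i = l \/ N <= v (u i - l).

Section ValuationRing.
Variables (K : fieldType) (v : dvaluation K).

Definition dv_int : {pred K} := [pred x | (x == 0) || (0 <= v x)].

Lemma dv_1 : v 1 = 0.
Proof.
apply: (addrI (v 1)).
by rewrite -[LHS]dv_mul ?oner_neq0 // mulr1 addr0.
Qed.

Lemma dv_N x : v (- x) = v x.
Proof.
have n1 : (-1 : K) != 0 by rewrite oppr_eq0 oner_eq0.
have h1 : v (-1) = 0.
  have := mulrn_eq0 (v (-1)) 2; rewrite mulr2n -dv_mul // mulrNN mulr1 dv_1.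
  by rewrite eqxx => /esym/eqP.
have [->|x0] := eqVneq x 0; first by rewrite oppr0.
by rewrite -mulN1r dv_mul // h1 add0r.
Qed.

Lemma dv_int_subring : subring_closed dv_int.
Proof.
split=> [|x y|x y]; rewrite !inE ?dv_1 ?lexx ?orbT //.
- have [->|x0] := eqVneq x 0; first by rewrite sub0r oppr_eq0 dv_N.
  have [->|y0] := eqVneq y 0; first by rewrite subr0 (negPf x0).
  have [//|xy0] := eqVneq (x - y) 0; rewrite /= => vx vy.
  have Ny0 : - y != 0 by rewrite oppr_eq0.
  have := dv_add v x0 Ny0 xy0; rewrite dv_N; apply: le_trans.
  by rewrite le_min vx vy.
- have [->|x0] := eqVneq x 0; first by rewrite mul0r eqxx.
  have [->|y0] := eqVneq y 0; first by rewrite mulr0 eqxx.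
  by rewrite /= => vx vy; rewrite dv_mul // addr_ge0 ?orbT.
Qed.

HB.instance Definition _ := GRing.isSubringClosed.Build K dv_int dv_int_subring.

Record dv_ring := DVRing { dv_ring_val :> K; _ : dv_ring_val \in dv_int }.

HB.instance Definition _ := [isSub for dv_ring_val].
HB.instance Definition _ := [Choice of dv_ring by <:].
HB.instance Definition _ := [SubChoice_isSubComNzRing of dv_ring by <:].

End ValuationRing.

Definition perfect_field (k : fieldType) : Prop :=
  forall p, p \in [pchar k] -> forall x : k, exists y, y ^+ p = x.

(* [rq_res] is the reduction map to the residue field of F0; [rq_conj] is the
   nontrivial automorphism of F over F0. *)
Record ramified_quadratic := RamifiedQuadratic {
  rq_F0 : fieldType;
  rq_v0 : dvaluation rq_F0;
  rq_pi0 : rq_F0;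
  rq_k : fieldType;
  rq_res : {rmorphism dv_ring rq_v0 -> rq_k};
  rq_F : fieldExtType rq_F0;
  rq_v : dvaluation rq_F;
  rq_pi : rq_F;
  rq_conj : {rmorphism rq_F -> rq_F};
  rq_complete : dv_complete rq_v0;
  rq_v0_pi0 : rq_v0 rq_pi0 = 1;
  rq_res_onto : forall y, exists x, rq_res x = y;
  rq_res_ker : forall x : dv_ring rq_v0,
    rq_res x = 0 <-> (val x = 0 \/ 0 < rq_v0 (val x));
  rq_k_perfect : perfect_field rq_k;
  rq_k_odd : (2%N \notin [pchar rq_k]);
  rq_quadratic : \dim {: rq_F} = 2%N;
  rq_ramified : forall a : rq_F0, a != 0 -> rq_v a%:A = rq_v0 a *+ 2;
  rq_v_pi : rq_v rq_pi = 1;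
  rq_pi_sqr : rq_pi ^+ 2 = rq_pi0%:A;
  rq_conj_id : forall a : rq_F0, rq_conj a%:A = a%:A;
  rq_conj_pi : rq_conj rq_pi = - rq_pi
}.

Section Rings.
Variable D : ramified_quadratic.

Definition OF0 := dv_ring (rq_v0 D).
Definition OF := dv_ring (rq_v D).
HB.instance Definition _ := GRing.ComNzRing.on OF0.
HB.instance Definition _ := GRing.ComNzRing.on OF.

Lemma pi0_int : rq_pi0 D \in dv_int (rq_v0 D).
Proof. by rewrite inE rq_v0_pi0 orbT. Qed.
Lemma pi_int : rq_pi D \in dv_int (rq_v D).
Proof. by rewrite inE rq_v_pi orbT. Qed.
Definition piO0 : OF0 := DVRing pi0_int.
Definition piO : OF := DVRing pi_int.

Lemma OF0_OF_int (a : OF0) : (val a)%:A \in dv_int (rq_v D).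
Proof.
rewrite inE; have [->|a0] := eqVneq (val a) 0; first by rewrite scale0r eqxx.
rewrite rq_ramified // mulrn_wge0 ?orbT //.
by have := valP a; rewrite inE (negPf a0).
Qed.
Definition OF0_OF (a : OF0) : OF := DVRing (OF0_OF_int a).

Lemma OF0_OF_zmod : zmod_morphism OF0_OF.
Proof. by move=> x y; apply: val_inj; rewrite /= scalerBl. Qed.
Lemma OF0_OF_monoid : monoid_morphism OF0_OF.
Proof.
split; first by apply: val_inj; rewrite /= scale1r.
by move=> x y; apply: val_inj; rewrite /= -scalerAl mul1r scalerA.
Qed.
HB.instance Definition _ := GRing.isZmodMorphism.Build OF0 OF OF0_OF OF0_OF_zmod.
HB.instance Definition _ :=
  GRing.isMonoidMorphism.Build OF0 OF OF0_OF OF0_OF_monoid.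

End Rings.

Section Lattice.
Variables (D : ramified_quadratic) (m : nat).
Local Notation n := (2 * m)%N.
Local Notation F := (rq_F D).
Local Notation pi := (rq_pi D).
Local Notation conj := (rq_conj D).

Definition herm (x y : 'rV[F]_n) : F := \sum_i conj (x 0 i) * y 0 (rev_ord i).

Definition basis_e (i : 'I_n) : 'rV[F]_n := delta_mx 0 i.

Lemma herm_basis i j : herm (basis_e i) (basis_e (rev_ord j)) = (i == j)%:R.
Proof.
rewrite /herm (bigD1 i) //= big1 => [|l li].
  by rewrite !mxE !eqxx /= rmorph1 mul1r addr0 (inj_eq rev_ord_inj).
by rewrite !mxE eqxx (negPf li) /= rmorph0 mul0r.
Qed.

Definition half_trace_form (x y : 'rV[F]_n) : F :=
  2^-1 * (herm x y + conj (herm x y)).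

(* The first n vectors of the O_F0-basis of Lambda_m; the last n are their
   images under multiplication by pi. *)
Definition basis_lambda (i : 'I_n) : 'rV[F]_n :=
  (if (i < m)%N then pi^-1 else 1) *: basis_e i.
Definition basis_f (j : 'I_(n + n)) : 'rV[F]_n :=
  match split j with
  | inl i => basis_lambda i
  | inr i => pi *: basis_lambda i
  end.

Lemma pi_neq0 : pi != 0.
Proof. by apply/eqP => p0; have := rq_v_pi D; rewrite p0 dv_zero. Qed.

Lemma herm_scale a b x y : herm (a *: x) (b *: y) = conj a * b * herm x y.
Proof.
rewrite /herm mulr_sumr; apply: eq_bigr => i _.
by rewrite !mxE rmorphM; ring.
Qed.

Lemma herm_lambda i j : herm (basis_lambda i) (basis_lambda j) =
  if j == rev_ord i then (-1) ^+ (i < m)%N * pi^-1 else 0.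
Proof.
rewrite herm_scale -[in basis_e j](rev_ordK j) herm_basis.
have -> : (i == rev_ord j) = (j == rev_ord i).
  by apply/eqP/eqP => ->; rewrite rev_ordK.
case: eqP => [->|_]; last by rewrite mulr0.
have -> : (rev_ord i < m)%N = ~~ (i < m)%N.
  by have := ltn_ord i; rewrite /=; case: (ltnP i m); lia.
case: (i < m)%N => /=.
  by rewrite fmorphV rq_conj_pi invrN !mulr1 expr1 mulN1r.
by rewrite rmorph1 expr0 mulr1.
Qed.

Lemma half_trace_integral (i j : 'I_(n + n)) :
  exists a : OF0 D, (val a)%:A == half_trace_form (basis_f i) (basis_f j).
Proof.
have p0 := pi_neq0.
have triv (x : F) : x + conj x = 0 ->
    exists a : OF0 D, (val a)%:A == 2^-1 * (x + conj x).
  by move=> ->; exists 0; rewrite /= mulr0 scale0r.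
have unit1 (b : bool) : exists a : OF0 D,
    (val a)%:A == 2^-1 * ((-1) ^+ b + conj ((-1) ^+ b)) :> F.
  have -> : conj ((-1) ^+ b) = (-1) ^+ b by rewrite rmorphXn rmorphN1.
  rewrite -mulr2n -[_ ^+ b *+ 2]mulr_natl mulrA.
  have [->|two0] := eqVneq (2%:R : F) 0.
    by exists 0; rewrite /= mulr0 mul0r scale0r.
  exists ((-1) ^+ b); rewrite mulVf // mul1r.
  by case: b => /=; rewrite ?scaleN1r ?scale1r.
have conjVp : conj pi^-1 = - pi^-1 by rewrite fmorphV rq_conj_pi invrN.
have conj_sign (b : bool) : conj ((-1) ^+ b) = (-1) ^+ b.
  by rewrite rmorphXn rmorphN1.
rewrite /half_trace_form /basis_f.
case: (split i) => i'; case: (split j) => j'.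
- rewrite herm_lambda; apply: triv; case: ifP => _.
    by rewrite rmorphM /= conj_sign conjVp mulrN subrr.
  by rewrite rmorph0 addr0.
- rewrite -[basis_lambda i']scale1r herm_scale rmorph1 mul1r herm_lambda.
  case: ifP => _; last by apply: triv; rewrite mulr0 rmorph0 addr0.
  by rewrite mulrCA mulfV // mulr1; apply: unit1.
- rewrite -[basis_lambda j']scale1r herm_scale rq_conj_pi mulr1 herm_lambda.
  case: ifP => _; last by apply: triv; rewrite mulr0 rmorph0 addr0.
  rewrite mulrCA mulNr mulfV //.
  have -> : (-1) ^+ (i' < m)%N * -1 = (-1) ^+ (~~ (i' < m)%N : bool) :> F.
    by case: (i' < m)%N; rewrite /= ?mulrNN ?mulr1 ?mul1r.
  exact: unit1.
- rewrite herm_scale rq_conj_pi herm_lambda; apply: triv.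
  case: ifP => _; last by rewrite mulr0 rmorph0 addr0.
  by rewrite !rmorphM rmorphN /= conj_sign conjVp rq_conj_pi; ring.
Qed.

(* Gram matrix of ( , ) in the basis f. *)
Definition gram : 'M[OF0 D]_(n + n) :=
  \matrix_(i, j) xchoose (half_trace_integral i j).

Lemma gramE i j :
  (val (gram i j))%:A = half_trace_form (basis_f i) (basis_f j).
Proof. by rewrite mxE; apply/eqP; exact: (xchooseP (half_trace_integral i j)). Qed.

(* Row i holds the coordinates of pi * f_i: with coordinates as row vectors,
   t is w |-> w *m tmat. *)
Definition tmat : 'M[OF0 D]_(n + n) := block_mx 0 1%:M (piO0 D)%:M 0.

Lemma tmatE i : pi *: basis_f i = \sum_j (val (tmat i j))%:A *: basis_f j.
Proof.
have fl k : basis_f (lshift n k) = basis_lambda k.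
  by rewrite /basis_f -[lshift n k]/(unsplit (inl k)) unsplitK.
have fr k : basis_f (rshift n k) = pi *: basis_lambda k.
  by rewrite /basis_f -[rshift n k]/(unsplit (inr k)) unsplitK.
rewrite big_split_ord /=; case: (split_ordP i) => k ->.
  rewrite big1 ?add0r => [|l _]; last by rewrite block_mxEul mxE scale0r scale0r.
  rewrite (bigD1 k) //= big1 ?addr0 => [|l lk].
    by rewrite block_mxEur mxE eqxx fl fr /= scale1r scale1r.
  by rewrite block_mxEur mxE eq_sym (negPf lk) scale0r scale0r.
rewrite [X in _ + X]big1 ?addr0 => [|l _]; last by rewrite block_mxEdr mxE scale0r scale0r.
rewrite (bigD1 k) //= big1 ?addr0 => [|l lk].
  by rewrite block_mxEdl mxE eqxx fl fr scalerA -expr2 rq_pi_sqr mulr1n.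
by rewrite block_mxEdl mxE eq_sym (negPf lk) mulr0n scale0r scale0r.
Qed.

End Lattice.

(* Submodules of R^N are predicates on row vectors. *)
Section Submodules.

Definition submod (R : comNzRingType) (N : nat) := 'rV[R]_N -> Prop.

Definition is_submod (R : comNzRingType) N (M : submod R N) : Prop :=
  M 0 /\ (forall (c : R) x y, M x -> M y -> M (c *: x + y)).

(* The S-span of the image, i.e. the image of M (x) S in S^N. *)
Definition base_change (R S : comNzRingType) (f : {rmorphism R -> S}) N
    (M : submod R N) : submod S N :=
  fun w => exists k (A : 'M[R]_(k, N)) (c : 'rV[S]_k),
    (forall i, M (row i A)) /\ w = c *m map_mx f A.

Definition is_basis (R : comNzRingType) d N (M : submod R N)
    (B : 'M[R]_(d, N)) : Prop :=
  (forall w, M w <-> exists c : 'rV_d, w = c *m B) /\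
  (forall c : 'rV_d, c *m B = 0 -> c = 0).

(* Free of rank d, with a retraction R^N -> M (given by C). *)
Definition free_summand (R : comNzRingType) d N (M : submod R N) : Prop :=
  exists (B : 'M[R]_(d, N)) (C : 'M[R]_(N, d)), is_basis M B /\ B *m C = 1%:M.

Definition invertible (R : comNzRingType) (x : R) : Prop := exists y, x * y = 1.

(* The D(g i) cover Spec R; M becomes a free direct summand over R[1/g i],
   hence over every R-algebra in which g i is invertible. *)
Definition local_summand (R : comNzRingType) d N (M : submod R N) : Prop :=
  is_submod M /\
  exists k (g a : 'I_k -> R), \sum_i a i * g i = 1 /\
    forall i (S : comNzRingType) (f : {rmorphism R -> S}),
      invertible (f (g i)) -> free_summand d (base_change f M).

Definition submod_mul (R : comNzRingType) N (M : submod R N)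
    (g : 'M[R]_N) : submod R N :=
  fun w => exists2 x, M x & w = x *m g.

End Submodules.

(* Functors of points on O-algebras (R, a : O -> R), of objects that are given
   by a submodule of R^N.  The zero ring, over which every scheme has exactly
   one point, is left out. *)
Section Schemes.
Variables (O : comNzRingType) (N : nat).

Definition submod_functor :=
  forall R : comNzRingType, {rmorphism O -> R} -> submod R N -> Prop.

(* Z -> X is a closed immersion: over an affine R-point x of X, the locus
   where x lies in Z is the vanishing locus of some I in R. *)
Definition closed_subfunctor (X Z : submod_functor) : Prop :=
  forall (R : comNzRingType) (a : {rmorphism O -> R}) (x : submod R N),
    X R a x -> exists I : R -> Prop,
    forall (S : comNzRingType) (b : {rmorphism O -> S}) (f : {rmorphism R -> S}),
      b =1 f \o a ->
      (Z S b (base_change f x) <-> forall y, I y -> f y = 0).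

Definition contains_generic_fiber (unif : O) (X Z : submod_functor) : Prop :=
  forall (R : comNzRingType) (a : {rmorphism O -> R}) (x : submod R N),
    invertible (a unif) -> X R a x -> Z R a x.

(* Scheme-theoretic closure in X of its generic fiber X[1/unif]: the
   intersection of the closed subschemes of X containing it. *)
Definition generic_closure (unif : O) (X : submod_functor) : submod_functor :=
  fun R a x => X R a x /\
    forall Z : submod_functor, closed_subfunctor X Z ->
      contains_generic_fiber unif X Z -> Z R a x.

(* char_{t|M} = chi for a locally free M: over every O-algebra S under R where
   M acquires a basis B, the matrix A of t in B has characteristic polynomial
   chi. *)
Definition char_poly_is (n : nat) (chi : {poly O}) (R : comNzRingType)
    (a : {rmorphism O -> R}) (t : 'M[R]_N) (M : submod R N) : Prop :=
  forall (S : comNzRingType) (f : {rmorphism R -> S})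
         (B : 'M[S]_(n, N)) (A : 'M[S]_n),
    is_basis (base_change f M) B -> B *m map_mx f t = A *m B ->
    char_poly A = map_poly (f \o a) chi.

End Schemes.

Section Models.
Variables (D : ramified_quadratic) (m : nat).
Local Notation n := (2 * m)%N.
Local Notation OF0 := (OF0 D).
Local Notation OF := (OF D).
Local Notation to_OF := (@OF0_OF D).

Section OverAlgebra.
Variables (R : comNzRingType) (a : {rmorphism OF0 -> R}).
Definition tR : 'M[R]_(n + n) := map_mx a (tmat D m).
Definition pairing (x y : 'rV[R]_(n + n)) : R :=
  (x *m map_mx a (gram D m) *m y^T) 0 0.
End OverAlgebra.

(* The naive model over O, for O_F0 -> O and chi in O[X]. *)
Definition Mnaive_over (O : comNzRingType) (i : {rmorphism OF0 -> O})
    (chi : {poly O}) : submod_functor O (n + n) :=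
  fun R a M =>
    [/\ local_summand n M,
        forall w, M w -> M (w *m tR (a \o i)),
        forall w w', M w -> M w' -> pairing (a \o i) w w' = 0
      & char_poly_is n chi a (tR (a \o i)) M].

Definition chi_OF (r s : nat) : {poly OF} :=
  ('X + (piO D)%:P) ^+ r * ('X - (piO D)%:P) ^+ s.

(* For r = s, the polynomial (X + pi)^r (X - pi)^s written in O_F0[X]. *)
Definition chi_OF0 (s : nat) : {poly OF0} := ('X ^+ 2 - (piO0 D)%:P) ^+ s.

Lemma chi_OF0E s : map_poly to_OF (chi_OF0 s) = chi_OF s s.
Proof.
rewrite /chi_OF0 /chi_OF -exprMn rmorphXn /= rmorphB /= map_polyXn map_polyC.
congr (_ ^+ s); rewrite mulrC -subr_sqr -polyC_exp; congr (_ - _%:P).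
by apply: val_inj; rewrite /= -rq_pi_sqr expr2.
Qed.

(* R-points, for R an O_F-algebra, of M^loc (x)_O O_F, where O is O_F0 if
   r = s and O_F otherwise. *)
Definition Mloc (r s : nat) : submod_functor OF (n + n) :=
  fun R a M =>
    if r == s
    then generic_closure (piO0 D) (Mnaive_over idfun (chi_OF0 s)) (a \o to_OF) M
    else generic_closure (piO D) (Mnaive_over to_OF (chi_OF r s)) a M.

Definition pair_functor :=
  forall R : comNzRingType, {rmorphism OF -> R} ->
    submod R (n + n) -> submod R (n + n) -> Prop.

Definition Mscr (s : nat) : pair_functor :=
  fun R a M0 M1 =>
    let t := tR (a \o to_OF) in let pi := a (piO D) in
    [/\ [/\ forall w, M0 w -> M1 w, local_summand s M0 & local_summand n M1],
        forall w, M1 w <-> (forall w', M1 w' -> pairing (a \o to_OF) w w' = 0),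
        forall w, M1 w -> M0 (w *m t + pi *: w)
      & forall w, M0 w -> w *m t - pi *: w = 0].

Definition Mspl (r s : nat) : pair_functor :=
  fun R a M0 M1 => Mscr s a M0 M1 /\ Mloc r s a M1.

(* Automorphisms of the polarized chain (pi^k Lambda_m)_k over an
   O_F0-algebra: g k is the automorphism of pi^k Lambda_m (x) R, in the basis
   (pi^k f_j).  In these bases the inclusion pi^(k+1) Lambda_m -> pi^k Lambda_m
   has matrix t, the periodicity isomorphism pi : pi^k Lambda_m ->
   pi^(k+1) Lambda_m is the identity matrix, and the duality between
   pi^k Lambda_m and pi^(-k) Lambda_m given by ( , ) is (-1)^k times the Gram
   matrix of Lambda_m. *)
Definition chain_aut (R : comNzRingType) (a : {rmorphism OF0 -> R})
    (g : int -> 'M[R]_(n + n)) : Prop :=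
  [/\ forall k, exists h, g k *m h = 1%:M /\ h *m g k = 1%:M,
      forall k, g k *m tR a = tR a *m g k,
      forall k, g (k + 1) *m tR a = tR a *m g k,
      forall k, g (k + 1) = g k
    & exists2 c : R, invertible c &
        forall k, g k *m map_mx a (gram D m) *m (g (- k))^T
                  = c *: map_mx a (gram D m)].

Definition chart (i1 i2 : 'I_n) : pair_functor :=
  fun R a M0 M1 =>
    [/\ Mscr 2 a M0 M1,
        forall y : 'rV[R]_n, exists! w, M1 w /\ rsubmx w = y
      & forall y1 y2 : R, exists! w,
          M0 w /\ w 0 (rshift n i1) = y1 /\ w 0 (rshift n i2) = y2].

(* The translates of U under the group scheme cover X: the image of the action
   morphism on G x U contains every point of X, i.e. every field-valued point
   of X lies, after a field extension, in a translate of U. *)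
Definition translates_cover (U X : pair_functor) : Prop :=
  forall (K : fieldType) (a : {rmorphism OF -> K}) (M0 M1 : submod K (n + n)),
    X K a M0 M1 ->
    exists (L : fieldType) (b : {rmorphism OF -> L}) (f : {rmorphism K -> L})
           (g : int -> 'M[L]_(n + n)) (U0 U1 : submod L (n + n)),
      [/\ b =1 f \o a, chain_aut (b \o to_OF) g, U L b U0 U1,
          forall w, base_change f M0 w <-> submod_mul U0 (g 0) w
        & forall w, base_change f M1 w <-> submod_mul U1 (g 0) w].

End Models.

(* Main.v *)
(* The group acts through Sp_n on the Levi part and through 1 + tE with E = WH,
   W skew, on the unipotent part.  Over a field K write a point as
   F_0 = {(pi y, y) : y in P} and F_1 = row space of (b1 | b2); then
   b1 + pi b2 = X P with X of size n x 2.  Transvections put the plane P in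
   general position with respect to any two coordinates, so only the
   transversality of F_1 to <f_1, ..., f_n>, i.e. the invertibility of b2, is at
   stake.  Isotropy makes it automatic for X = 0, and achievable by an element
   1 + tE for X of rank 2.  Rank 1 can only happen in the special fibre, where it
   is the wrong component of the orthogonal Grassmannian.  That component is
   excluded on the closure of the generic fibre by n determinantal equations:
   F_1 is never transversal to a reflection of <f_1, ..., f_n>.  They must be
   verified over arbitrary, possibly nonreduced, algebras: there F_1 is completed
   to an isometry g of the hyperbolic form, the equations follow from det g = 1 by
   Jacobi's complementary minor identity, and det g = 1 is extracted from
   det (t | F_1) = pi^n by expanding det (p + (1 - p)), for p the projector of F_1
   onto one of the eigenspaces of t, along all sets of rows. *)
From HB Require Import structures.
Require Import Defs.
From mathcomp Require Import all_boot all_order all_algebra all_field.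
From mathcomp Require Import boolp ring zify.

Set Implicit Arguments.
Unset Strict Implicit.
Unset Printing Implicit Defensive.

Import Order.TTheory GRing.Theory Num.Theory.
Local Open Scope ring_scope.

(** By the binomial theorem, the elements having a power that kills [y] are closed under addition.
    This glues vanishing statements along the cover by the loci where [x i] is invertible. *)
Lemma pow_annihilator (R : comNzRingType) (I : finType) (x : I -> R) (y : R) :
  \sum_i x i = 1 -> (forall i, exists k, x i ^+ k * y = 0) -> y = 0.
Proof.
move=> sx hx.
suff [k] : exists k, (\sum_i x i) ^+ k * y = 0 by rewrite sx expr1n mul1r.
apply: (big_ind (fun z => exists k, z ^+ k * y = 0)) => [|a b [k ha] [l hb]|i _].
- by exists 1%N; rewrite expr1 mul0r.
- exists (k + l)%N; rewrite exprDn mulr_suml big1 // => i _.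
  rewrite mulrnAl; case: (leqP k (k + l - i)%N) => hk.
    by rewrite -(subnK hk) exprD mulrAC -!mulrA ha !mulr0 mul0rn.
  have hl : (l <= i)%N by lia.
  by rewrite -(subnK hl) exprD -!mulrA hb !mulr0 mul0rn.
- exact: hx.
Qed.

Lemma double_eq0 (R : pzRingType) (V : lmodType R) (h : R) (x : V) :
  h *+ 2 = 1 -> x + x = 0 -> x = 0.
Proof.
move=> h2 xx.
by rewrite -[x]scale1r -h2 mulr2n scalerDl -scalerDr xx scaler0.
Qed.

(** * Isometries of the hyperbolic form *)

Section SwapForm.
Variables (R : comNzRingType) (n : nat).
Implicit Types (a b c d p r s u : 'M[R]_n) (g : 'M[R]_(n + n)) (J : {set 'I_n}).

Definition swap_mx : 'M[R]_(n + n) := block_mx 0 1%:M 1%:M 0.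

Definition swap_isometry g := g *m swap_mx *m g^T = swap_mx.

Lemma swap_isometry_mul g1 g2 :
  swap_isometry g1 -> swap_isometry g2 -> swap_isometry (g1 *m g2).
Proof.
rewrite /swap_isometry => h1 h2.
by rewrite trmx_mul mulmxA -(mulmxA g1) -(mulmxA g1) h2 h1.
Qed.

Lemma swap_isometryP a b c d : swap_isometry (block_mx a b c d) <->
  [/\ a *m b^T + b *m a^T = 0, c *m b^T + d *m a^T = 1%:M
    & c *m d^T + d *m c^T = 0].
Proof.
rewrite /swap_isometry tr_block_mx !mulmx_block !mulmx1 !mulmx0 !add0r !addr0.
split=> [/eq_block_mx[ab _ cd dc]|[ab cd dc]]; first by split; rewrite // addrC.
rewrite /swap_mx; congr (block_mx _ _ _ _); rewrite addrC //.
by rewrite -[LHS]trmxK linearD /= !trmx_mul !trmxK addrC cd trmx1.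
Qed.

(* Jacobi's complementary minor identity: the inverse of the isometry g has
   blocks d^T, b^T, c^T, a^T. *)
Lemma swap_isometry_minor a b c d : swap_isometry (block_mx a b c d) ->
  \det (block_mx a b c d) * \det d = \det d.
Proof.
move=> /swap_isometryP[_ cd dc].
have ad : a *m d^T + b *m c^T = 1%:M.
  by rewrite -[LHS]trmxK linearD /= !trmx_mul !trmxK addrC cd trmx1.
rewrite -[X in _ * X = _]mulr1 -[X in _ * (X * _)]det_tr -(det1 R n).
rewrite -(det_lblock d^T c^T) -det_mulmx mulmx_block !mulmx0 !add0r !mulmx1.
by rewrite ad dc det_ublock det1 mul1r.
Qed.

Definition coord_proj J : 'M[R]_n := diag_mx (\row_j (j \in J)%:R).

Lemma coord_projK J : coord_proj J *m coord_proj J = coord_proj J.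
Proof.
rewrite mulmx_diag; congr diag_mx; apply/rowP => j.
by rewrite !mxE; case: (j \in J); rewrite ?mulr1 ?mulr0.
Qed.

Lemma coord_projC J : 1%:M - coord_proj J = coord_proj (~: J).
Proof.
apply/matrixP => i j; rewrite !mxE inE; case: eqP => _; last by rewrite subr0.
by case: (i \in J); rewrite ?subrr ?subr0.
Qed.

Lemma coord_proj_orth J : coord_proj J *m coord_proj (~: J) = 0.
Proof. by rewrite -coord_projC mulmxBr mulmx1 coord_projK subrr. Qed.

Lemma coord_proj_orthC J : coord_proj (~: J) *m coord_proj J = 0.
Proof. by rewrite -coord_projC mulmxBl mul1mx coord_projK subrr. Qed.

Lemma coord_projD J : coord_proj J + coord_proj (~: J) = 1%:M.
Proof. by rewrite -coord_projC addrC subrK. Qed.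

Lemma tr_coord_proj J : (coord_proj J)^T = coord_proj J.
Proof. exact: tr_diag_mx. Qed.

Lemma mul_coord_proj m J (M : 'M[R]_(n, m)) i j :
  (coord_proj J *m M) i j = if i \in J then M i j else 0.
Proof.
by rewrite mul_diag_mx !mxE; case: (i \in J); rewrite ?mul1r ?mul0r.
Qed.

(** Multilinearity in the rows: [J] is the set of rows taken from [p]. *)
Lemma det_addmx p r :
  \det (p + r) = \sum_J \det (coord_proj J *m p + coord_proj (~: J) *m r).
Proof.
rewrite exchange_big; apply: eq_bigr => s _ /=; rewrite -mulr_sumr.
congr (_ * _); under eq_bigr do rewrite mxE.
rewrite bigA_distr; apply: eq_bigr => J _; apply: eq_bigr => i _.
by rewrite mxE !mul_coord_proj inE; case: (i \in J); rewrite /= ?addr0 ?add0r.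
Qed.

Lemma det_coord_sign J :
  \det (coord_proj (~: J) - coord_proj J) = (-1) ^+ #|J|.
Proof.
rewrite -raddfB det_diag -prodr_const [RHS]big_mkcond; apply: eq_bigr => i _.
by rewrite !mxE inE; case: (i \in J); rewrite ?sub0r ?subr0.
Qed.

(** The product of the reflections exchanging the i-th basis vector with its dual, for i in [J]. *)
Definition flip_mx J : 'M[R]_(n + n) :=
  block_mx (coord_proj (~: J)) (coord_proj J) (coord_proj J) (coord_proj (~: J)).

Lemma flip_isometry J : swap_isometry (flip_mx J).
Proof.
apply/swap_isometryP.
rewrite !tr_coord_proj !coord_projK coord_proj_orth coord_proj_orthC.
by rewrite addr0 coord_projD.
Qed.

Lemma det_flip J : \det (flip_mx J) = (-1) ^+ #|J|.
Proof.
have e : block_mx 1%:M 1%:M 0 1%:M *m flip_mx J *m block_mx 1%:M (- 1%:M) 0 1%:M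
   = block_mx 1%:M 0 (coord_proj J) (coord_proj (~: J) - coord_proj J).
  rewrite !mulmx_block !mul1mx !mul0mx !mulmx0 !mulmxN !mulmx1 !addr0 !add0r.
  by rewrite (addrC (coord_proj (~: J))) coord_projD addNr [- _ + _]addrC.
have := congr1 determinant e.
rewrite !det_mulmx !det_ublock det_lblock !det1 !mul1r mulr1 => ->.
exact: det_coord_sign.
Qed.

Local Notation E := coord_proj.
Local Notation E' J := (coord_proj (~: J)).

(* With q J the summand of det (p + r) = 1 indexed by J, flipping the
   coordinates in J makes a complementary minor equal to a unit times q J ^+ 2,
   so that det g = (-1) ^+ #|J| on the locus where q J is invertible; and the
   sum of the (-1) ^+ #|J| * q J is det u. *)
Lemma swap_isometry_det1 (h : R) a b c d u :
  h *+ 2 = 1 -> ~~ odd n -> swap_isometry (block_mx a b c d) ->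
  u *m c = c -> u *m d = - d -> \det u = 1 -> \det (block_mx a b c d) = 1.
Proof.
move=> h2 n2 isog uc ud detu.
have /swap_isometryP[_ cd dc] := isog.
set p := c *m b^T in cd; set r := d *m a^T in cd.
(* [u] fixes [c] and negates [d], so applying it to [dc] flips the relative sign of the two terms;
   as 2 is invertible, both vanish. *)
have cdT : c *m d^T = 0.
  apply: (double_eq0 h2); rewrite -[RHS](mulmx0 _ u) -dc mulmxDr !mulmxA uc ud.
  rewrite mulNmx; congr (_ + _); apply/eqP; rewrite -addr_eq0; exact/eqP.
have dcT : d *m c^T = 0 by rewrite -[LHS]trmxK trmx_mul trmxK cdT trmx0.
have up : u *m p = p by rewrite /p mulmxA uc.
have ur : u *m r = - r by rewrite /r mulmxA ud mulNmx.
have bc : b *m c^T = p^T by rewrite trmx_mul trmxK.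
have da : d *m a^T = r by [].
clearbody p r.
(* Since [p + r = 1], the next identities make [p] and [r] the complementary idempotents belonging
   to the eigenvalues 1 and -1 of [u]. *)
have uE : u = p - r by rewrite -[LHS]mulmx1 -cd mulmxDr up ur.
have rE : r = 1%:M - p by rewrite -cd addrAC subrr add0r.
have rr : r *m r = r.
  apply/eqP; rewrite eq_sym -subr_eq0; apply/eqP; apply: (double_eq0 h2).
  rewrite -[RHS](subrr r) -[X in _ = _ + X]ur uE [p](_ : _ = 1%:M - r).
    by rewrite !mulmxBl mul1mx addrACA -!addrA.
  by rewrite rE subKr.
have pE : p = 1%:M - r by rewrite rE subKr.
have pr : p *m r = 0 by rewrite pE mulmxBl mul1mx rr subrr.
have rp : r *m p = 0 by rewrite pE mulmxBr mulmx1 rr subrr.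
have pp : p *m p = p by rewrite -[RHS]mulmx1 -cd mulmxDr pr addr0.
pose q J := \det (E J *m p + E' J *m r).
pose s J : 'M[R]_n := E' J - E J.
have qsign J : \det (E J *m - p + E' J *m r) = (-1) ^+ #|J| * q J.
  rewrite -det_coord_sign -det_mulmx; congr (\det _).
  rewrite mulmxDr !mulmxBl !mulmxA !coord_projK coord_proj_orth coord_proj_orthC.
  by rewrite !mul0mx sub0r subr0 mulmxN.
have sum_q : \sum_J q J = 1 by rewrite -det_addmx cd det1.
have sum_sq : \sum_(J : {set 'I_n}) (-1) ^+ #|J| * q J = 1.
  under eq_bigr do rewrite -qsign.
  rewrite -det_addmx addrC (_ : r - p = - u); last by rewrite uE opprB.
  by rewrite -scaleN1r detZ detu mulr1 -signr_odd (negPf n2).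
have qE J : q J = \det (p *m E J + r *m E' J).
  have e1 : E J *m - p + E' J *m r = r - E J.
    by rewrite -coord_projC mulmxBl mul1mx mulmxN addrCA -opprD -mulmxDr cd mulmx1.
  have e2 : (p *m E J + r *m E' J) *m s J = r - E J.
    rewrite mulmxBr !mulmxDl -!mulmxA !coord_projK coord_proj_orth.
    rewrite coord_proj_orthC !mulmx0 add0r addr0 -coord_projC mulmxBr mulmx1.
    by rewrite -addrA -opprD -mulmxDl [r + p]addrC cd mul1mx.
  have := qsign J; rewrite e1 -e2 det_mulmx det_coord_sign mulrC.
  move/(congr1 ( *%R ((-1) ^+ #|J|))); rewrite !mulrA -expr2 sqrr_sign.
  by rewrite !mul1r => ->.
(* The row form and the column form of [q J] are multiplied: orthogonality of [p] and [r] leaves a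
   matrix that is block diagonal with respect to [J] and its complement. *)
have qqE J : q J ^+ 2 =
    \det (E J *m p *m E J + E' J) * \det (E J + E' J *m r *m E' J).
  rewrite expr2 {2}qE -det_mulmx mulrC -det_mulmx; congr (\det _).
  transitivity (E J *m (p *m E J) + E' J *m (r *m E' J)).
    rewrite mulmxDl !mulmxDr !mulmxA -!(mulmxA (E J)) -!(mulmxA (E' J)).
    by rewrite pp pr rp rr !mul0mx !mulmx0 addr0 add0r.
  rewrite mulmxDl !mulmxDr !mulmxA coord_projK coord_proj_orth.
  rewrite -!mulmxA coord_projK (mulmxA (E' J) (E J)) coord_proj_orthC.
  by rewrite mul0mx !mulmx0 addr0 add0r.
have parity J : (1 - (-1) ^+ #|J| * \det (block_mx a b c d)) * q J ^+ 2 = 0.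
  pose d' := E J *m b + E' J *m d.
  have flipE : flip_mx J *m block_mx a b c d =
      block_mx (E' J *m a + E J *m c) (E' J *m b + E J *m d)
               (E J *m a + E' J *m c) d'.
    exact: mulmx_block.
  have := swap_isometry_mul (flip_isometry J) isog.
  rewrite flipE => /swap_isometry_minor.
  rewrite -flipE det_mulmx det_flip => minor.
  pose y := E J *m (b *m a^T) *m E' J.
  have yy : y *m y = 0.
    by rewrite /y !mulmxA -(mulmxA _ (E' J) (E J)) coord_proj_orthC !(mulmx0, mul0mx).
  (* This exhibits [q J ^+ 2], up to the unit [\det (1%:M + y)], as a multiple of the minor
     [\det d']. *)
  have d'E : d' *m (c^T *m E J + a^T *m E' J) = (E J + E' J *m r *m E' J) *m
      (1%:M + y) *m (E J *m p^T *m E J + E' J).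
    have -> : d' *m (c^T *m E J + a^T *m E' J) =
        E J *m p^T *m E J + y + E' J *m r *m E' J.
      rewrite /d' mulmxDl !mulmxDr -!mulmxA (mulmxA b) (mulmxA b) (mulmxA d) (mulmxA d).
      by rewrite bc dcT da mul0mx mulmx0 add0r /y !mulmxA.
    have -> : (E J + E' J *m r *m E' J) *m (1%:M + y) = E J + E' J *m r *m E' J + y.
      rewrite mulmxDr mulmx1 mulmxDl /y !mulmxA coord_projK.
      by rewrite -(mulmxA _ (E' J) (E J)) coord_proj_orthC mulmx0 !mul0mx addr0.
    rewrite mulmxDr !mulmxDl /y -!mulmxA !(mulmxA (E' J) (E J)).
    rewrite !coord_proj_orthC !mul0mx !mulmx0 !(mulmxA (E J) (E J)) !coord_projK.
    by rewrite coord_proj_orth !addr0 add0r addrAC addrA.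
  have detd' : \det d' * \det (c^T *m E J + a^T *m E' J) = \det (1%:M + y) * q J ^+ 2.
    rewrite -det_mulmx d'E !det_mulmx qqE -(det_tr (E J *m p *m E J + E' J)).
    by rewrite linearD /= !trmx_mul !tr_coord_proj mulmxA; ring.
  have dety : \det (1%:M + y) * \det (1%:M - y) = 1.
    by rewrite -det_mulmx mulmxBr mulmx1 mulmxDl mul1mx yy addr0 addrK det1.
  move: detd' => /(congr1 ( *%R (1 - (-1) ^+ #|J| * \det (block_mx a b c d)))).
  rewrite mulrA mulrBl mul1r minor subrr mul0r.
  move/(congr1 ( *%R (\det (1%:M - y)))); rewrite mulr0 => zero.
  rewrite -[LHS]mul1r -{1}dety [RHS]zero; ring.
set ep := \det _ in parity *.
apply/eqP; rewrite eq_sym -subr_eq0; apply/eqP.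
(* These weights sum to 1 by [sum_q] and [sum_sq]; they are 0 for [#|J|] odd and [q J] for [#|J|]
   even, where [parity] gives annihilation by the square. *)
apply: (@pow_annihilator _ _ (fun J => h * (1 + (-1) ^+ #|J|) * q J)).
  under eq_bigr do rewrite -mulrA mulrDl mul1r.
  by rewrite -mulr_sumr big_split /= sum_q sum_sq mulrDr mulr1 -mulr2n.
move=> J; exists 2%N; move: (parity J); rewrite -signr_odd; case: (odd _) => /=.
  by rewrite expr1 subrr mulr0 mul0r expr0n mul0r.
rewrite expr0 mul1r -mulr2n -mulr_natr mul1r mulr_natr h2 mul1r => pJ.
by rewrite mulrC.
Qed.

End SwapForm.

Lemma trmxD (R : nmodType) m n (M N : 'M[R]_(m, n)) : (M + N)^T = M^T + N^T.
Proof. by apply/matrixP => i j; rewrite !mxE. Qed.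

Lemma trmxB (R : zmodType) m n (M N : 'M[R]_(m, n)) : (M - N)^T = M^T - N^T.
Proof. by apply/matrixP => i j; rewrite !mxE. Qed.

Lemma trmxZ (R : pzRingType) m n c (M : 'M[R]_(m, n)) : (c *: M)^T = c *: M^T.
Proof. by apply/matrixP => i j; rewrite !mxE. Qed.

(** * Lagrangians, their completion to isometries, and the vanishing minors *)

Section Lagrangian.
Variables (R : comNzRingType) (n : nat) (h : R).
Hypothesis h2 : h *+ 2 = 1.

(** The rows of [(X2^T | X1^T)] are dual to those of [(B1 | B2)], with symmetric Gram matrix [s];
    subtracting half of [s] times [(B1 | B2)] makes them isotropic. *)
Lemma lagrangian_complement (B1 B2 X1 X2 : 'M[R]_n) :
  B1 *m B2^T + B2 *m B1^T = 0 -> B1 *m X1 + B2 *m X2 = 1%:M ->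
  exists a b, swap_isometry (block_mx a b B1 B2).
Proof.
move=> isoB BX.
pose s := X2^T *m X1 + X1^T *m X2.
have sT : s^T = s by rewrite trmxD !trmx_mul !trmxK addrC.
have XB : X2^T *m B2^T + X1^T *m B1^T = 1%:M.
  by rewrite -!trmx_mul -trmxD addrC BX trmx1.
exists (X2^T - h *: (s *m B1)), (X1^T - h *: (s *m B2)).
apply/swap_isometryP; rewrite !trmxB !trmxZ !trmx_mul !trmxK sT.
split=> //.
- transitivity (s - h *: s - h *: s); last first.
    by rewrite -addrA -opprD -scalerDl -mulr2n h2 scale1r subrr.
  rewrite !mulmxBl !mulmxBr -!scalemxAl -!scalemxAr.
  rewrite addrACA -[X in _ + X]opprD; congr (_ - _).
    by rewrite addrACA -opprD -scalerDr !mulmxA -mulmxDl XB mul1mx.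
  rewrite addrACA -opprD -!scalerDr -!(mulmxA s) -!mulmxDr BX mulmx1.
  by rewrite !mulmxA -mulmxDl isoB mul0mx mulmx0 !scaler0 subr0.
- rewrite !mulmxBr addrACA BX -!scalemxAr !mulmxA -opprD -scalerDr -mulmxDl.
  by rewrite isoB mul0mx scaler0 subr0.
Qed.

(** Here [A] is the matrix of t on the Lagrangian and [p] a square root of pi_0. Once the completed
    isometry has determinant 1, its composite with a single reflection has determinant -1, and the
    complementary minor identity forces the minor to vanish. *)
Lemma lagrangian_minor (H B1 B2 X1 X2 A : 'M[R]_n) (p pV : R) (i : 'I_n) :
  ~~ odd n -> H^T = - H -> H *m H^T = 1%:M -> p * pV = 1 ->
  B1 *m B2^T + B2 *m B1^T = 0 -> B1 *m X1 + B2 *m X2 = 1%:M ->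
  A *m B1 = p ^+ 2 *: (B2 *m H) -> A *m B2 = B1 *m H^T -> \det A = p ^+ n ->
  \det (B1 *m coord_proj R [set i] + B2 *m coord_proj R (~: [set i])) = 0.
Proof.
move=> n_even HT HHT pp isoB BX AB1 AB2 detA.
have HTH : H^T *m H = 1%:M by apply: mulmx1C.
have [a [b isog]] := lagrangian_complement isoB BX.
suff det1g : \det (block_mx a b B1 B2) = 1.
  have := swap_isometry_mul isog (flip_isometry R [set i]).
  rewrite /flip_mx mulmx_block => /swap_isometry_minor.
  rewrite -mulmx_block det_mulmx det_flip det1g cards1 expr1 mul1r mulN1r.
  move=> e; rewrite -[LHS]mulr1 -h2 mulrnAr -mulrnAl mulr2n.
  by rewrite -{1}e addNr mul0r.
(* The unipotent isometries [n1] and [n2] replace the lower blocks by [c] and [d], on which [A] acts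
   as [- p] and [p]. *)
pose c := B1 - p *: (B2 *m H).
pose d := B2 + (h * pV) *: (c *m H^T).
pose n1 := block_mx 1%:M 0 (- (p *: H)) 1%:M.
pose n2 := block_mx 1%:M ((h * pV) *: H^T) 0 1%:M.
have HTHr : H *m H = - 1%:M by rewrite -[X in X *m _]opprK -HT mulNmx HTH.
have HHr : H^T *m H^T = - 1%:M by rewrite {1}HT mulNmx HHT.
have Ac : A *m c = - p *: c.
  rewrite mulmxBr AB1 -scalemxAr mulmxA AB2 -mulmxA HTH mulmx1 scaleNr.
  by rewrite scalerBr opprB scalerA expr2.
have Ad : A *m d = p *: d.
  rewrite mulmxDr AB2 -scalemxAr mulmxA Ac -scalemxAl scalerDr !scalerA.
  have -> : B1 *m H^T = p *: B2 + c *m H^T.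
    by rewrite mulmxBl -scalemxAl -mulmxA HHT mulmx1 addrC subrK.
  rewrite -addrA; congr (_ + _); rewrite -[X in X + _]scale1r -scalerDl; congr (_ *: _).
  by rewrite -h2; ring: pp.
have isog' : swap_isometry (block_mx a b B1 B2 *m n1 *m n2).
  apply: swap_isometry_mul; first apply: swap_isometry_mul => //.
    apply/swap_isometryP; rewrite !trmx1 !trmx0 !mulmx0 !mul0mx mulmx1 mul1mx.
    rewrite !add0r raddfN /= trmxZ HT scalerN opprK mulmx1 addNr.
    by split; rewrite ?addr0.
  apply/swap_isometryP; rewrite !trmx1 !trmx0 !mulmx0 !mul0mx mulmx1 mul1mx.
  by rewrite !add0r trmxZ trmxK HT scalerN ?mulmx1 ?mul1mx subrr; split; rewrite ?addr0.
have gE : block_mx a b B1 B2 *m n1 *m n2 =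
    block_mx (a - p *: (b *m H)) ((a - p *: (b *m H)) *m ((h * pV) *: H^T) + b) c d.
  rewrite !mulmx_block !mulmx1 !mulmx0 !add0r !addr0 !mulmxN -!scalemxAr -/c.
  by rewrite /d [B2 + _]addrC.
have detn : \det (block_mx a b B1 B2 *m n1 *m n2) = \det (block_mx a b B1 B2).
  by rewrite !det_mulmx det_lblock det_ublock !det1 !mulr1.
rewrite -detn gE; rewrite gE in isog'.
(* Rescaled by [- pV], [A] fixes [c] and negates [d]; evenness of [n] makes its determinant 1. *)
apply: (swap_isometry_det1 (u := - pV *: A) h2 n_even isog').
- by rewrite -scalemxAl Ac scalerA mulrNN mulrC pp scale1r.
- by rewrite -scalemxAl Ad scalerA mulNr mulrC pp scaleN1r.
- by rewrite detZ detA -exprMn mulNr mulrC pp -signr_odd (negPf n_even).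
Qed.

End Lagrangian.

(** * Localization and adjunction of a square root *)

Section IdealQuotient.
Variables (R : comNzRingType) (I : R -> Prop).
Hypotheses (I0 : I 0) (I1 : ~ I 1).
Hypothesis IMD : forall a x y, I x -> I y -> I (a * x + y).

Let S : {pred R} := fun x => `[< I x >].

Let S_ideal : idealr_closed S.
Proof.
split=> [| |a x y]; [exact/asboolP|exact/asboolP|].
by move=> /asboolP Ix /asboolP Iy; apply/asboolP; apply: IMD.
Qed.
HB.instance Definition _ := isIdealr.Build R S S_ideal.

Lemma quotient_ring : exists (Q : comNzRingType) (f : {rmorphism R -> Q}),
  forall x, f x = 0 <-> I x.
Proof.
exists {ideal_quot S}, \pi_({ideal_quot S})%qT => x.
have e : (\pi_({ideal_quot S})%qT x == 0) = (x \in S).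
  by rewrite -[in RHS](subr0 x) Quotient.idealrBE rmorph0.
by split=> [/eqP|Ix]; [rewrite e => /asboolP|apply/eqP; rewrite e; apply/asboolP].
Qed.
End IdealQuotient.

(** The test root is the class of X in R[X]/(p). *)
Lemma adjoin_root (R : comNzRingType) (p : {poly R}) (y : R) :
  (forall (S : comNzRingType) (f : {rmorphism R -> S}) (x : S),
     root (map_poly f p) x -> f y = 0) ->
  exists q, y%:P = q * p.
Proof.
(* If [p] generates the unit ideal, the quotient is the zero ring, which [comNzRingType] excludes;
   but then every constant is a multiple of [p]. *)
move=> hy; have [[q q1]|n1] := EM (exists q, 1 = q * p).
  by exists (y%:P * q); rewrite -mulrA -q1 mulr1.
have [| |Q [f fE]] := @quotient_ring _ (fun z => exists q, z = q * p) _ n1.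
- by exists 0; rewrite mul0r.
- by move=> a _ _ [q ->] [r ->]; exists (a * q + r); rewrite mulrDl mulrA.
apply/fE; apply: (hy Q (f \o polyC) (f 'X)).
rewrite /root map_poly_comp horner_map /=.
rewrite -[(map_poly _ p).['X]]/(p \Po 'X) comp_polyXr; apply/eqP/fE.
by exists 1; rewrite mul1r.
Qed.

(** The localization is R[X]/(gX - 1). Comparing coefficients in [y = q (gX - 1)] shows that
    [g ^+ k * y] is minus the k-th coefficient of [q], which is zero for large k. *)
Lemma localization_kernel (R : comNzRingType) (g y : R) :
  (forall (S : comNzRingType) (f : {rmorphism R -> S}),
     invertible (f g) -> f y = 0) ->
  exists k, g ^+ k * y = 0.
Proof.
move=> hy; have [|q yq] := @adjoin_root R (g *: 'X - 1) y.
  move=> S f x; rewrite /root rmorphB /= map_polyZ map_polyX rmorph1 !hornerE.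
  by rewrite subr_eq0 => /eqP gx; apply: hy; exists x.
exists (size q).
have yk k : g ^+ k * y = - q`_k.
  elim: k => [|k IHk].
    have := congr1 (fun r : {poly R} => r`_0) yq.
    rewrite coefC /= expr0 mul1r mulrBr mulr1 -scalerAr.
    by rewrite coefB coefZ coefMX mulr0 sub0r.
  have := congr1 (fun r : {poly R} => r`_k.+1) yq.
  rewrite coefC /= mulrBr mulr1 -scalerAr coefB coefZ coefMX /= => /eqP.
  by rewrite eq_sym subr_eq0 => /eqP <-; rewrite exprS -mulrA IHk mulrN.
by rewrite yk nth_default ?oppr0.
Qed.

(** R injects into R[X]/(X^2 - c): a nonzero multiple of a monic quadratic polynomial is not
    constant. *)
Lemma adjoin_sqrt (R : comNzRingType) (c y : R) :
  (forall (S : comNzRingType) (f : {rmorphism R -> S}) (x : S),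
     x ^+ 2 = f c -> f y = 0) ->
  y = 0.
Proof.
move=> hy; have [|q yq] := @adjoin_root R ('X^2 - c%:P) y.
  move=> S f x; rewrite /root rmorphB /= map_polyXn map_polyC !hornerE.
  by rewrite subr_eq0 => /eqP xc; apply: hy xc.
have [q0|q0] := eqVneq q 0.
  by move: yq; rewrite q0 mul0r => /eqP; rewrite polyC_eq0 => /eqP.
have := congr1 (fun r : {poly R} => size r) yq.
rewrite size_Mmonic ?monicXnsubC // size_XnsubC // size_polyC.
by move: q0; rewrite -size_poly_gt0; case: (y != 0); lia.
Qed.

(** * The spin condition on the closure of the generic fibre *)

Section SignMatrix.
Variable m : nat.
Local Notation n := (2 * m)%N.

(** The matrix of [pi * herm] on f_1, ..., f_n: a symplectic form, called [H] further on. *)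
Definition sign_mx (R : pzRingType) : 'M[R]_n :=
  \matrix_(i, j) if j == rev_ord i then (-1) ^+ (i < m)%N else 0.

Lemma rev_ord_lt (i : 'I_n) : (rev_ord i < m)%N = ~~ (i < m)%N.
Proof. by have := ltn_ord i; rewrite /=; case: (ltnP i m); lia. Qed.

Lemma tr_sign_mx R : (sign_mx R)^T = - sign_mx R.
Proof.
apply/matrixP => i j; rewrite !mxE -[in i == _](rev_ordK i) (inj_eq rev_ord_inj) eq_sym.
case: eqP => [->|_]; last by rewrite oppr0.
by rewrite rev_ord_lt; case: (i < m)%N; rewrite /= ?expr1 ?expr0 ?opprK.
Qed.

Lemma sign_mxK R : sign_mx R *m (sign_mx R)^T = 1%:M.
Proof.
apply/matrixP => i j; rewrite !mxE (bigD1 (rev_ord i)) //= big1 ?addr0 => [|k ki].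
  rewrite !mxE eqxx (inj_eq rev_ord_inj); case: eqP => [<-|_]; last by rewrite mulr0.
  by rewrite -expr2 sqrr_sign.
by rewrite !mxE (negPf ki) mul0r.
Qed.

Lemma map_sign_mx (R S : pzRingType) (f : {rmorphism R -> S}) :
  map_mx f (sign_mx R) = sign_mx S.
Proof.
by apply/matrixP => i j; rewrite !mxE; case: ifP; rewrite ?rmorph_sign ?rmorph0.
Qed.

End SignMatrix.

(** * The Gram matrix in block form *)

Section Gram.
Variables (D : ramified_quadratic) (m : nat).
Local Notation n := (2 * m)%N.

(** Odd residue characteristic means that 2 has valuation 0. *)
Lemma OF0_half : exists h : OF0 D, h *+ 2 = 1.
Proof.
have two_res : rq_res D 2%:R != 0.
  by apply: contra (rq_k_odd D) => e; rewrite inE /= -(rmorph_nat (rq_res D)).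
have two0 : val (2%:R : OF0 D) != 0.
  by apply: contra two_res => /eqP e; apply/eqP/rq_res_ker; left.
have v2 : rq_v0 D (val (2%:R : OF0 D)) = 0.
  apply/eqP; rewrite eq_le; apply/andP; split.
    rewrite leNgt; apply: contra two_res => lt0; apply/eqP/rq_res_ker.
    by right.
  by have := valP (2%:R : OF0 D); rewrite inE (negPf two0).
have hV : (val (2%:R : OF0 D))^-1 \in dv_int (rq_v0 D).
  have inv0 : (val (2%:R : OF0 D))^-1 != 0 by rewrite invr_eq0.
  have := dv_mul (rq_v0 D) two0 inv0; rewrite mulfV // v2 dv_1 add0r => e.
  by rewrite inE -e lexx orbT.
exists (DVRing hV); apply: val_inj.
by rewrite -[DVRing hV *+ 2]mulr_natl; apply: mulfV.
Qed.

(** Conjugation negates the values of [herm] on f_1, ..., f_n, so the trace survives only when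
    exactly one of the two arguments carries a factor pi. *)
Lemma gram_blocks :
  gram D m = block_mx 0 (sign_mx m (OF0 D)) (sign_mx m (OF0 D))^T 0.
Proof.
have two0 : (2%:R : rq_F D) != 0.
  have [h h2] := OF0_half.
  have e : (val h)%:A * 2%:R = 1 :> rq_F D.
    rewrite mulr_natr -[RHS]scale1r -[X in _ = X *: _]/(val (1 : OF0 D)) -h2.
    by rewrite mulr2n scalerDl.
  by apply/eqP => two; move/eqP: e; rewrite two mulr0 eq_sym oner_eq0.
have half (x : rq_F D) : 2^-1 * (x + x) = x.
  by rewrite -mulr2n -[x *+ 2]mulr_natl mulrA mulVf ?mul1r.
have fl (k : 'I_n) : basis_f D (lshift n k) = basis_lambda D k.
  by rewrite /basis_f -[lshift n k]/(unsplit (inl k)) unsplitK.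
have fr (k : 'I_n) : basis_f D (rshift n k) = rq_pi D *: basis_lambda D k.
  by rewrite /basis_f -[rshift n k]/(unsplit (inr k)) unsplitK.
have signE (k l : 'I_n) : (val (sign_mx m (OF0 D) k l))%:A =
    rq_pi D * herm (basis_lambda D k) (basis_lambda D l).
  rewrite mxE herm_lambda; case: eqP => _; last by rewrite mulr0 scale0r.
  rewrite mulrCA mulfV ?pi_neq0 // mulr1.
  by case: (k < m)%N; rewrite /= ?expr1 ?expr0 ?scaleN1r ?scale1r.
have signN k l : (sign_mx m (OF0 D))^T k l = - sign_mx m (OF0 D) k l.
  by rewrite tr_sign_mx mxE.
have conjS k l : rq_conj D (val (sign_mx m (OF0 D) k l))%:A =
    (val (sign_mx m (OF0 D) k l))%:A := rq_conj_id _.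
apply/matrixP => i j; apply: val_inj.
apply: (fmorph_inj (GRing.in_alg (rq_F D))).
rewrite -[LHS]/((val (gram D m i j))%:A) gramE /half_trace_form.
have conj_herm (k l : 'I_n) : rq_conj D (herm (basis_lambda D k) (basis_lambda D l)) =
    - herm (basis_lambda D k) (basis_lambda D l).
  apply: (mulfI (pi_neq0 D)); rewrite mulrN -signE -[in RHS]conjS signE.
  by rewrite rmorphM rq_conj_pi mulNr opprK.
case: (split_ordP i) => k ->; case: (split_ordP j) => l ->; rewrite ?fl ?fr.
- by rewrite conj_herm subrr mulr0 block_mxEul mxE /= scale0r.
- rewrite -[X in herm X]scale1r herm_scale rmorph1 mul1r -signE conjS half.
  by rewrite block_mxEur.
- rewrite -[X in herm _ X]scale1r herm_scale mulr1 rq_conj_pi mulNr -signE.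
  rewrite rmorphN conjS half block_mxEdl signN.
  by rewrite -[RHS]/((- val (sign_mx m (OF0 D) k l))%:A) scaleNr.
- rewrite herm_scale 2!rmorphM conj_herm rq_conj_pi rmorphN rq_conj_pi.
  by rewrite block_mxEdr mxE /= scale0r; ring.
Qed.

End Gram.

(** Multilinearity expands [\det (C *m A)] over all choices of rows of [A], repetitions included. *)
Lemma det_mulmx_rowsub (R : comNzRingType) n k (C : 'M[R]_(n, k)) (A : 'M[R]_(k, n)) :
  (forall s : {ffun 'I_n -> 'I_k}, \det (rowsub s A) = 0) -> \det (C *m A) = 0.
Proof.
move=> hA.
have -> : \det (C *m A) =
    \sum_(s : {ffun 'I_n -> 'I_k}) (\prod_i C i (s i)) * \det (rowsub s A).
  under [RHS]eq_bigr do rewrite mulr_sumr.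
  rewrite exchange_big; apply: eq_bigr => t _ /=.
  under eq_bigr do rewrite mxE.
  rewrite bigA_distr_bigA mulr_sumr; apply: eq_bigr => s _ /=.
  rewrite big_split mulrCA; congr (_ * (_ * _)).
  by apply: eq_bigr => i _; rewrite !mxE.
by rewrite big1 // => s _; rewrite hA mulr0.
Qed.

(** * Tuples in a base change, and the spin condition as a closed condition *)

Section BaseChange.
Variables (R S : comNzRingType) (f : {rmorphism R -> S}) (N : nat) (M : submod R N).

Lemma base_change_rows q (B : 'M[S]_(q, N)) :
  (forall j, base_change f M (row j B)) ->
  exists k (A : 'M[R]_(k, N)) (C : 'M[S]_(q, k)),
    (forall i, M (row i A)) /\ B = C *m map_mx f A.
Proof.
elim: q B => [|q IHq] B hB.
  by exists 0%N, 0, 0; split=> [[]//|]; apply/matrixP => [[]].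
have [k1 [A1 [c1 [hA1 e1]]]] := hB ord0.
have [|k2 [A2 [C2 [hA2 e2]]]] := IHq (dsubmx (B : 'M_(1 + q, N))).
  move=> j; suff -> : row j (dsubmx (B : 'M_(1 + q, N))) = row (lift ord0 j) B by [].
  by rewrite row_dsubmx; congr (row _ B); apply: val_inj.
exists (k1 + k2)%N, (col_mx A1 A2), (block_mx c1 0 0 C2); split.
  by move=> i; case: (split_ordP i) => j ->; rewrite ?rowKu ?rowKd.
rewrite map_col_mx (@mul_block_col _ 1 q) !mul0mx addr0 add0r -e1 -e2.
rewrite -[LHS](@vsubmxK _ 1 q N).
suff -> : usubmx (B : 'M_(1 + q, N)) = row ord0 B by [].
by apply/rowP => j; rewrite !mxE; congr (B _ _); apply: val_inj.
Qed.

Lemma base_change_row q (B : 'M[R]_(q, N)) :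
  (forall j, M (row j B)) -> forall j, base_change f M (row j (map_mx f B)).
Proof.
by move=> hB j; exists q, B, (delta_mx 0 j); split; rewrite ?rowE.
Qed.

End BaseChange.

Section Spin.
Variable m : nat.
Local Notation n := (2 * m)%N.

(* The coordinates along Lambda_m modulo the Lagrangian obtained from
   <f_1, ..., f_n> by the reflection exchanging f_i and its dual vector. *)
Definition reflected_coord (R : comNzRingType) (i : 'I_n) : 'M[R]_(n + n, n) :=
  col_mx (coord_proj R [set i]) ((sign_mx m R)^T *m coord_proj R (~: [set i])).

Lemma map_coord_proj (R S : comNzRingType) (f : {rmorphism R -> S}) J :
  map_mx f (@coord_proj R n J) = coord_proj S J.
Proof. by apply/matrixP => i j; rewrite !mxE rmorphMn /= rmorph_nat. Qed.

Lemma map_reflected_coord (R S : comNzRingType) (f : {rmorphism R -> S}) i :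
  map_mx f (reflected_coord R i) = reflected_coord S i.
Proof. by rewrite map_col_mx map_mxM -map_trmx map_sign_mx !map_coord_proj. Qed.

(* Quantifying over all n-tuples in M, not only over local bases, makes this
   closed without localizing: the determinant is multilinear in the tuple. *)
Definition spin_condition (O : comNzRingType) : submod_functor O (n + n) :=
  fun R a M => forall B : 'M[R]_(n, n + n), (forall k, M (row k B)) ->
    forall i, \det (B *m reflected_coord R i) = 0.

(** The equations are the determinants of n-tuples of [M] over [R] itself. A tuple in the base
    change is a matrix times the image of such elements, so its determinant is a combination of
    these equations. *)
Lemma spin_condition_closed (O : comNzRingType) (X : submod_functor O (n + n)) :
  closed_subfunctor X (@spin_condition O).
Proof.
move=> R a M _.
exists (fun y => exists2 B : 'M[R]_(n, n + n), (forall k, M (row k B)) &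
  exists i, y = \det (B *m reflected_coord R i)).
move=> S b f _; split=> [spinM _ [B hB [i ->]]|killI B hB i].
  by rewrite -det_map_mx map_mxM map_reflected_coord; apply/spinM/base_change_row.
have [k [A [C [hA ->]]]] := base_change_rows hB.
rewrite -mulmxA; apply: det_mulmx_rowsub => s.
rewrite -(map_reflected_coord f) -map_mxM -map_mxsub det_map_mx.
apply: killI; exists (rowsub s A) => [j|]; first by rewrite row_rowsub.
by exists i; rewrite mul_rowsub_mx.
Qed.

End Spin.

(** * The spin condition where the uniformizer is invertible *)

Section GenericFiber.
Variables (D : ramified_quadratic) (m : nat).
Local Notation n := (2 * m)%N.

Lemma gram_map (R : comNzRingType) (a : {rmorphism OF0 D -> R}) :
  map_mx a (gram D m) = block_mx 0 (sign_mx m R) (sign_mx m R)^T 0.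
Proof. by rewrite gram_blocks map_block_mx !map_mx0 -map_trmx map_sign_mx. Qed.

Lemma tR_blocks (R : comNzRingType) (a : {rmorphism OF0 D -> R}) :
  tR m a = block_mx 0 1%:M (a (piO0 D))%:M 0.
Proof. by rewrite /tR /tmat map_block_mx !map_mx0 !map_scalar_mx rmorph1. Qed.

Lemma invertible_rmorph (R S : comNzRingType) (f : {rmorphism R -> S}) x :
  invertible x -> invertible (f x).
Proof. by case=> y xy; exists (f y); rewrite -rmorphM xy rmorph1. Qed.

Lemma pairing_rows (R : comNzRingType) (a : {rmorphism OF0 D -> R})
    p q (A : 'M[R]_(p, n + n)) (B : 'M[R]_(q, n + n)) :
  (forall i j, pairing a (row i A) (row j B) = 0) ->
  A *m map_mx a (gram D m) *m B^T = 0.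
Proof.
move=> h; apply/matrixP => i j; rewrite [RHS]mxE -(h i j) /pairing.
by rewrite -row_mul tr_row -row_mul colE mulmxA -colE !mxE.
Qed.

(** Vanishing may be tested after localizing until [M] is free and after adjoining a square root [x]
    of pi_0; there [lagrangian_minor] applies to a basis of [M]. *)
Lemma spin_condition_generic (O : comNzRingType) (i : {rmorphism OF0 D -> O})
    (chi : {poly O}) (R : comNzRingType) (a : {rmorphism O -> R})
    (M : submod R (n + n)) :
  chi`_0 = i (piO0 D) ^+ m -> invertible (a (i (piO0 D))) ->
  Mnaive_over i chi a M -> spin_condition a M.
Proof.
move=> chi0 pi_inv [[[_ linM] [k [g [c [gc free]]]]] tM isoM charM] B0 hB0 idx.
apply: (pow_annihilator gc) => j.
suff [l hl] : exists l, g j ^+ l * \det (B0 *m reflected_coord R idx) = 0.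
  by exists l; rewrite exprMn -mulrA hl mulr0.
apply: localization_kernel => S1 f1 f1g.
apply: (adjoin_sqrt (c := f1 (a (i (piO0 D))))) => S f2 x xx.
pose f : {rmorphism R -> S} := f2 \o f1.
have fg : invertible (f (g j)) := invertible_rmorph f2 f1g.
have [B [X [[MB Bfree] BX]]] := free j S f fg.
rewrite -[LHS]/(f _) -det_map_mx map_mxM map_reflected_coord.
have [C ->] : exists C : 'M_n, map_mx f B0 = C *m B.
  have rows j' : exists c' : 'rV_n, row j' (map_mx f B0) = c' *m B.
    exact/MB/base_change_row.
  have [c' hc'] := choice rows.
  by exists (\matrix_j' c' j'); apply/row_matrixP => j'; rewrite row_mul rowK hc'.
rewrite -mulmxA det_mulmx.
have Brow l : base_change f M (row l B) by apply/MB; exists (delta_mx 0 l); rewrite rowE.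
have tE : map_mx f (tR m (a \o i)) = tR m (f \o (a \o i)) by rewrite /tR -map_mx_comp.
pose c0 := f (a (i (piO0 D))).
have [A BA] : exists A : 'M_n, B *m tR m (f \o (a \o i)) = A *m B.
  have rows l : exists c' : 'rV_n, row l (B *m tR m (f \o (a \o i))) = c' *m B.
    apply/MB; rewrite row_mul; have [q [E [d [hE ->]]]] := Brow l.
    exists q, (E *m tR m (a \o i)), d; split => [l'|]; first by rewrite row_mul; apply: tM.
    by rewrite map_mxM tE mulmxA.
  have [c' hc'] := choice rows.
  by exists (\matrix_l c' l); apply/row_matrixP => l; rewrite [RHS]row_mul rowK hc'.
have isoB : B *m map_mx (f \o (a \o i)) (gram D m) *m B^T = 0.
  apply: pairing_rows => l l'; rewrite /pairing.
  have [q [E [d [hE ->]]]] := Brow l; have [q' [E' [d' [hE' ->]]]] := Brow l'.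
  have EE' : E *m map_mx (a \o i) (gram D m) *m E'^T = 0.
    by apply: pairing_rows => u u'; apply: isoM.
  have -> : d *m map_mx f E *m map_mx (f \o (a \o i)) (gram D m) *m (d' *m map_mx f E')^T
      = d *m map_mx f (E *m map_mx (a \o i) (gram D m) *m E'^T) *m d'^T.
    by rewrite !map_mxM -map_trmx -map_mx_comp trmx_mul !mulmxA.
  by rewrite EE' map_mx0 mulmx0 mul0mx mxE.
have charA : char_poly A = map_poly (f \o a) chi.
  by apply: (charM S f B A); [split|rewrite tE].
(* The constant coefficient of the characteristic polynomial is the determinant, with trivial sign
   because n is even. *)
have detA : \det A = x ^+ n.
  have := char_poly_det A; rewrite charA coef_map chi0 /= !rmorphXn /=.
  by rewrite -signr_odd oddM expr0 mul1r exprM xx => <-.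
pose b1 := lsubmx B; pose b2 := rsubmx B.
have BE : B = row_mx b1 b2 by rewrite hsubmxK.
have H1 := sign_mxK m S; have H2 := mulmx1C H1.
have [h h2] := OF0_half D.
have [x' xx'] : invertible x.
  have [y hy] : invertible (f (a (i (piO0 D)))) := invertible_rmorph f pi_inv.
  by exists (x * y); rewrite mulrA -expr2 xx.
(* Multiplying the second block by the transposed sign matrix turns the Gram matrix into
   [swap_mx]. *)
have -> : B *m reflected_coord S idx = b1 *m coord_proj S [set idx]
    + (b2 *m (sign_mx m S)^T) *m coord_proj S (~: [set idx]).
  by rewrite BE mul_row_col mulmxA.
move: BA isoB; rewrite tR_blocks gram_map BE.
rewrite mul_row_block mul_row_block mul_mx_row tr_row_mx mul_row_col.
rewrite !mulmx0 !add0r !addr0 mulmx1 => /eq_row_mx[Ab1 Ab2] iso.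
have hS : f (a (i h)) *+ 2 = 1 by rewrite -!rmorphMn h2 !rmorph1.
rewrite (@lagrangian_minor _ _ _ hS (sign_mx m S) _ _ (usubmx X)
   (sign_mx m S *m dsubmx X) A x x') ?mulr0 //.
- by rewrite oddM.
- exact: tr_sign_mx.
- by rewrite trmx_mul trmxK mulmxA -[RHS]iso addrC.
- by rewrite mulmxA -(mulmxA b2) H2 mulmx1 -mul_row_col -BE vsubmxK.
- by rewrite -mulmxA H2 mulmx1 -Ab1 mul_mx_scalar xx.
- by rewrite mulmxA -Ab2.
Qed.

End GenericFiber.

(** The closure lies in every closed subfunctor containing the generic fibre. Over either base ring
    the constant coefficient of the characteristic polynomial is pi_0^m, because s = 2 is even. *)
Lemma spin_condition_Mloc (D : ramified_quadratic) (m : nat) (R : comNzRingType)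
    (a : {rmorphism OF D -> R}) (M : submod R (2 * m + 2 * m)) :
  (0 < m)%N -> @Mloc D m (2 * m - 2) 2 R a M -> spin_condition a M.
Proof.
move=> m0; have to_pi0 : OF0_OF (piO0 D) = piO D ^+ 2.
  by apply: val_inj; rewrite /= -rq_pi_sqr.
rewrite /Mloc; case: eqP => [m2|_] [_].
  move/(_ (@spin_condition m (OF0 D)) (@spin_condition_closed _ _ _)); apply.
  move=> S b N pi_inv; apply: spin_condition_generic => //=.
  rewrite -horner_coef0 /chi_OF0 !hornerE /= expr0n sub0r mulrNN -expr2.
  by congr (_ ^+ _); lia.
move/(_ (@spin_condition m (OF D)) (@spin_condition_closed _ _ _)); apply.
move=> S b N [y pi_y]; apply: spin_condition_generic => /=.
  rewrite -horner_coef0 /chi_OF !hornerE /= -mulrA mulrNN -expr2 -exprD to_pi0 -exprM.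
  by congr (_ ^+ _); lia.
by exists (y ^+ 2); rewrite to_pi0 rmorphXn -exprMn pi_y expr1n.
Qed.

(** * Moving a field-valued point into the chart *)

Section Symplectic.
Variables (K : fieldType) (n : nat) (H : 'M[K]_n).
Hypotheses (two0 : (2%:R : K) != 0) (HT : H^T = - H) (HK : H *m H^T = 1%:M).

Lemma mx11_neq0 (M : 'M[K]_1) : (M != 0) = (M 0 0 != 0).
Proof. by rewrite [M]mx11_scalar -scalemx1 scaler_eq0 oner_eq0 orbF !mxE mulr1. Qed.

(** Two proper hyperplanes never cover a vector space, over any field: a basis vector or a sum of
    two avoids both. *)
Lemma nonzero_functionals (u : 'rV[K]_n) (w : 'cV[K]_n) : u != 0 -> w != 0 ->
  exists v : 'rV[K]_n, u *m v^T != 0 /\ v *m w != 0.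
Proof.
move=> /rV0Pn[i ui] /cV0Pn[j wj].
have uE k : (u *m (delta_mx 0 k)^T) 0 0 = u 0 k.
  rewrite mxE (bigD1 k) //= big1 => [|l lk]; first by rewrite !mxE !eqxx mulr1 addr0.
  by rewrite !mxE eqxx (negPf lk) mulr0.
have wE k : (delta_mx 0 k *m w) 0 0 = w k 0.
  rewrite mxE (bigD1 k) //= big1 => [|l lk]; first by rewrite !mxE !eqxx mul1r addr0.
  by rewrite !mxE eqxx (negPf lk) mul0r.
have [wi|wi] := eqVneq (w i 0) 0; last first.
  by exists (delta_mx 0 i); rewrite !mx11_neq0 uE wE.
have [uj|uj] := eqVneq (u 0 j) 0; last first.
  by exists (delta_mx 0 j); rewrite !mx11_neq0 uE wE.
exists (delta_mx 0 i + delta_mx 0 j); rewrite trmxD mulmxDr mulmxDl !mx11_neq0.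
have addE (x y : 'M[K]_1) : (x + y) 0 0 = x 0 0 + y 0 0 by rewrite mxE.
by rewrite !addE !uE !wE uj wi addr0 add0r.
Qed.

(** Multiplying by [r] shows that [b] lies in the new row space, which therefore contains that of
    [N]; [s] shows that [b] is not in the latter. *)
Lemma rank_add_mx1 p q (N : 'M[K]_(p, q)) (a : 'cV_p) (b : 'rV_q) (r : 'rV_p) (s : 'cV_q) :
  r *m N = 0 -> N *m s = 0 -> r *m a != 0 -> b *m s != 0 ->
  (\rank N < \rank (N + a *m b)%R)%N.
Proof.
move=> rN Ns ra bs.
have bN' : (b <= (N + a *m b)%R)%MS.
  apply/submxP; exists (((r *m a) 0 0)^-1 *: r).
  rewrite mulmxDr -!scalemxAl rN scaler0 add0r mulmxA {2}[r *m a]mx11_scalar.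
  by rewrite mul_scalar_mx scalerA mulVf ?scale1r // -mx11_neq0.
apply: rank_ltmx; rewrite ltmxE; apply/andP; split.
  by rewrite -[X in (X <= _)%MS](addrK (a *m b)) addmx_sub ?eqmx_opp // mulmx_sub.
apply: contra bs => /(submx_trans bN') /submxP[c ->].
by rewrite -mulmxA Ns mulmx0.
Qed.

Definition symplectic (T : 'M[K]_n) := T *m H *m T^T = H.

Lemma symplectic_mul T1 T2 : symplectic T1 -> symplectic T2 -> symplectic (T1 *m T2).
Proof.
rewrite /symplectic => h1 h2.
by rewrite trmx_mul mulmxA -(mulmxA T1) -(mulmxA T1) h2 h1.
Qed.

Lemma symplectic_unit T : symplectic T -> T \in unitmx.
Proof.
move=> h; have : T *m (H *m T^T *m H^T) = 1%:M by rewrite !mulmxA h HK.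
by case/mulmx1_unit.
Qed.

Lemma skew_form0 (v : 'rV[K]_n) : v *m H *m v^T = 0.
Proof.
apply/matrixP => i j; rewrite !ord1 [RHS]mxE; apply/eqP.
have : (v *m H *m v^T)^T = - (v *m H *m v^T).
  by rewrite !trmx_mul trmxK HT mulNmx mulmxN mulmxA.
move/(congr1 (fun M : 'M_1 => M 0 0)); rewrite !mxE => /eqP.
by rewrite -addr_eq0 -mulr2n -mulr_natr mulf_eq0 (negPf two0) orbF.
Qed.

Lemma symplectic_transvection (v : 'rV[K]_n) : symplectic (1%:M + H *m v^T *m v).
Proof.
rewrite /symplectic trmxD trmx1 !trmx_mul trmxK mulmxDr mulmx1 mulmxDl mul1mx.
rewrite -[RHS]addr0 -addrA; congr (_ + _).
rewrite mulmxDl HT !(mulmxN, mulmxA) -[X in _ + (_ - X)]mulmxA.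

rewrite addrA subrr sub0r -!mulmxA (mulmxA v H (v^T *m _)) (mulmxA (v *m H)).
by rewrite skew_form0 mul0mx !mulmx0 oppr0.
Qed.

(** While the rank of [P *m T *m Q] is below 2, a suitable transvection raises it, so two of them
    suffice. *)
Lemma symplectic_general_position (P : 'M[K]_(2, n)) (Q : 'M[K]_(n, 2)) :
  row_free P -> row_free Q^T ->
  exists T, symplectic T /\ P *m T *m Q \in unitmx.
Proof.
have step (P' : 'M[K]_(2, n)) : row_free P' -> row_free Q^T -> (\rank (P' *m Q) < 2)%N ->
  exists T, symplectic T /\ (\rank (P' *m Q) < \rank (P' *m T *m Q))%N.
  move=> Pf Qf lt2; set N := P' *m Q in lt2 *.
  pose r := nz_row (kermx N); pose s := (nz_row (kermx N^T))^T.
  have r0 : r != 0 by rewrite nz_row_eq0 -mxrank_eq0 mxrank_ker; lia.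
  have s0 : s^T != 0.
    by rewrite trmxK nz_row_eq0 -mxrank_eq0 mxrank_ker mxrank_tr; lia.
  have rN : r *m N = 0 by apply/sub_kermxP; apply: nz_row_sub.
  have Ns : N *m s = 0.
    by apply: trmx_inj; rewrite trmx_mul trmx0 trmxK; apply/sub_kermxP/nz_row_sub.
  have u0 : r *m P' *m H != 0.
    apply: contra r0 => /eqP rPH; rewrite -(mulmx_free_eq0 _ Pf).
    by rewrite -[r *m P']mulmx1 -HK mulmxA rPH mul0mx.
  have w0 : Q *m s != 0.
    apply: contra s0 => /eqP Qs; rewrite -(mulmx_free_eq0 _ Qf) -trmx_mul Qs.
    by rewrite trmx0.
  (* The transvection along [v] adds the product of [P' *m H *m v^T] and [v *m Q] to [N]; [v] is
     chosen so that [r] and [s] do not kill these factors. *)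
  have [v [uv vw]] := nonzero_functionals u0 w0.
  exists (1%:M + H *m v^T *m v); split; first exact: symplectic_transvection.
  rewrite mulmxDr mulmxDl mulmx1 -/N !mulmxA -(mulmxA _ v Q).
  by apply: rank_add_mx1 rN Ns _ _; rewrite ?mulmxA // -mulmxA.
move=> Pf Qf.
have full T : \rank (P *m T *m Q) = 2%N -> P *m T *m Q \in unitmx.
  by rewrite -row_free_unit /row_free => ->.
have move1 T : symplectic T -> (\rank (P *m T *m Q) < 2)%N ->
    exists T', symplectic T' /\ (\rank (P *m T *m Q) < \rank (P *m T' *m Q))%N.
  move=> sT lt2; have PTf : row_free (P *m T).
    by rewrite /row_free mxrankMfree // row_free_unit symplectic_unit.
  have [T' [sT' lt]] := step _ PTf Qf lt2.
  by exists (T *m T'); split; [apply: symplectic_mul|rewrite mulmxA].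
have s1 : symplectic 1%:M by rewrite /symplectic mul1mx trmx1 mulmx1.
have bound T := rank_leq_row (P *m T *m Q).
have [|lt1] := leqP 2 (\rank (P *m 1%:M *m Q)).
  by exists 1%:M; split=> //; apply: full; move: (bound 1%:M); lia.
have [T [sT rT]] := move1 _ s1 lt1.
have [|lt2] := leqP 2 (\rank (P *m T *m Q)).
  by exists T; split=> //; apply: full; move: (bound T); lia.
have [T' [sT' rT']] := move1 _ sT lt2.
by exists T'; split=> //; apply: full; move: (bound T'); lia.
Qed.

End Symplectic.

Lemma injective_unitmx (K : fieldType) n (A : 'M[K]_n) :
  (forall x : 'rV_n, x *m A = 0 -> x = 0) -> A \in unitmx.
Proof.
move=> injA; rewrite -row_free_unit -kermx_eq0 -nz_row_eq0; apply/eqP/injA.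
exact/sub_kermxP/nz_row_sub.
Qed.

Lemma ord2P (k : 'I_2) : k = 0 \/ k = 1.
Proof. by case: k => [[|[|//]] lt]; [left|right]; apply: val_inj. Qed.

Lemma skew_mx2 (K : fieldType) (Z : 'M[K]_2) :
  (2%:R : K) != 0 -> Z + Z^T = 0 -> Z = 0 \/ Z \in unitmx.
Proof.
move=> two0 ZT.
have skew i j : Z i j = - Z j i.
  by apply/eqP; rewrite -addr_eq0; have /matrixP/(_ i j) := ZT; rewrite !mxE => ->.
have diag i : Z i i = 0.
  have := skew i i => /eqP; rewrite -addr_eq0 -mulr2n -mulr_natr mulf_eq0.
  by rewrite (negPf two0) orbF => /eqP.
have [z0|z0] := eqVneq (Z 0 1) 0; [left|right].
  apply/matrixP => i j; rewrite mxE.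
  by case: (ord2P i) (ord2P j) => -> [] ->; rewrite ?diag // skew z0 oppr0.
apply: injective_unitmx => x xZ.
have xZE j : x 0 0 * Z 0 j + x 0 1 * Z 1 j = 0.
  have /matrixP/(_ 0 j) := xZ; rewrite !mxE !big_ord_recl big_ord0 addr0.
  by rewrite (_ : lift 0 0 = 1) //; apply: val_inj.
have x0 : x 0 0 = 0.
  by have /eqP := xZE 1; rewrite diag mulr0 addr0 mulf_eq0 (negPf z0) orbF => /eqP.
have x1 : x 0 1 = 0.
  have /eqP := xZE 0; rewrite diag mulr0 add0r skew mulrN oppr_eq0 mulf_eq0.
  by rewrite (negPf z0) orbF => /eqP.
by apply/rowP => j; rewrite mxE; case: (ord2P j) => ->.
Qed.

(** * Transversality according to the rank of [X] *)

Section LagrangianMove.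
Variables (K : fieldType) (n : nat) (H : 'M[K]_n) (pi : K).
Hypotheses (two0 : (2%:R : K) != 0) (HT : H^T = - H) (HK : H *m H^T = 1%:M).
Variables (b1 b2 : 'M[K]_n).
Hypothesis B_free : forall x : 'rV_n, x *m b1 = 0 -> x *m b2 = 0 -> x = 0.
Hypothesis B_iso : b1 *m H *m b2^T + b2 *m H^T *m b1^T = 0.

(** Isotropy gives [Y = Z *m X^T] with [Z] a skew 2 by 2 matrix, hence zero or invertible. If [Z] is
    invertible, the kernel of [b2] is killed by [X], so it is zero; if [Z = 0], the unipotent
    element attached to [W] achieves transversality. *)
Lemma lagrangian_rank2 (P : 'M[K]_(2, n)) (X : 'M[K]_(n, 2)) (W : 'M[K]_n) :
  row_free X^T -> b1 + pi *: b2 = X *m P -> P *m W *m P^T \in unitmx ->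
  W *m H *m W = 0 ->
  b2 \in unitmx \/ b2 + b1 *m (W *m H) \in unitmx.
Proof.
move=> Xf CE PWP WHW; set C := _ + _ in CE.
have [X' X'X] : exists X', X' *m X = 1%:M.
  have /row_freeP[X' h] := Xf; exists X'^T; apply: trmx_inj.
  by rewrite trmx_mul trmxK h trmx1.
pose Y := P *m H *m b2^T.
have YT : Y^T = b2 *m H^T *m P^T by rewrite /Y !trmx_mul trmxK mulmxA.
have XY : X *m Y + Y^T *m X^T = 0.
  have -> : X *m Y = b1 *m H *m b2^T + pi *: (b2 *m H *m b2^T).
    by rewrite /Y !mulmxA -CE /C !mulmxDl -!scalemxAl.
  have -> : Y^T *m X^T = b2 *m H^T *m b1^T + pi *: (b2 *m H^T *m b2^T).
    by rewrite YT -!mulmxA -trmx_mul -CE /C trmxD trmxZ !mulmxDr -!scalemxAr.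
  rewrite addrACA B_iso add0r -scalerDr HT mulmxN mulNmx.
  by rewrite subrr scaler0.
pose Z := - (X' *m Y^T).
have YZ : Y = Z *m X^T.
  rewrite /Z mulNmx -mulmxA; apply/eqP; rewrite -addr_eq0; apply/eqP.
  by rewrite -[X in X + _]mul1mx -X'X -mulmxA -mulmxDr XY mulmx0.
have ZT : Z + Z^T = 0.
  have X'XT : X^T *m X'^T = 1%:M by rewrite -trmx_mul X'X trmx1.
  have := congr1 (fun M => X' *m M *m X'^T) XY.
  rewrite mulmx0 mul0mx YZ trmx_mul trmxK mulmxDr mulmxDl !mulmxA X'X !mul1mx.
  by rewrite -!mulmxA X'XT !mulmx1.
have xC (x : 'rV_n) : x *m b2 = 0 -> x *m X = 0 -> x = 0.
  move=> xb2 xX; apply: (B_free _ xb2).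
  have -> : b1 = X *m P - pi *: b2 by rewrite -CE addrK.
  by rewrite mulmxBr mulmxA xX mul0mx -scalemxAr xb2 scaler0 subr0.
have [Z0|Zu] := skew_mx2 two0 ZT; [right|left]; apply: injective_unitmx => x hx.
  have Y0 : Y = 0 by rewrite YZ Z0 mul0mx.
  have hx' : x *m (b2 + X *m P *m (W *m H)) = 0.
    (* The factor [1%:M + pi *: (W *m H)] replaces [b1] by [X *m P]; the quadratic term drops out
       since [W *m H *m W = 0]. *)
    have -> : b2 + X *m P *m (W *m H) =
        (b2 + b1 *m (W *m H)) *m (1%:M + pi *: (W *m H)).
      have WH2 : W *m H *m (W *m H) = 0 by rewrite !mulmxA WHW mul0mx.
      rewrite -CE /C mulmxDr mulmx1 !mulmxDl -!scalemxAr -!scalemxAl.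
      rewrite -(mulmxA b1) WH2 mulmx0.
      by rewrite scaler0 addr0 addrA.
    by rewrite mulmxA hx mul0mx.
  (* Multiplication by [H^T *m P^T] kills the term in [b2], as [Y = 0], and leaves [x *m X] times
     the invertible [P *m W *m P^T]. *)
  have xX : x *m X = 0.
    have : x *m (b2 + X *m P *m (W *m H)) *m (H^T *m P^T) = 0 by rewrite hx' mul0mx.
    rewrite mulmxDr mulmxDl -[x *m b2 *m _]mulmxA (mulmxA b2) -YT Y0 trmx0 mulmx0 add0r.
    rewrite !mulmxA -(mulmxA _ H) HK mulmx1 -!mulmxA (mulmxA P) (mulmxA x).
    by move/(congr1 (mulmxr (invmx (P *m W *m P^T)))); rewrite /= mulmxK ?mul0mx.
  apply: xC => //; move: hx'.
  by rewrite mulmxDr !mulmxA xX !mul0mx addr0.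
apply: xC => //; apply: trmx_inj; rewrite trmx0 trmx_mul.
have : Z *m (X^T *m x^T) = 0.
  by rewrite mulmxA -YZ /Y -!mulmxA -trmx_mul hx trmx0 !mulmx0.
by move/(congr1 (mulmx (invmx Z))); rewrite mulKmx // mulmx0.
Qed.

(** Such a Lagrangian is transversal to a reflected one, at any index [i] with [w 0 i] nonzero.
    Isotropy forces [z = 0], so a kernel vector [u] kills [x], and [u *m Y] is supported at [i] and
    orthogonal to [w], hence zero. *)
Lemma lagrangian_rank1 (x : 'cV[K]_n) (w : 'rV[K]_n) : x *m w != 0 -> b1 = x *m w ->
  exists i, \det (b1 *m coord_proj K [set i]
                  + b2 *m H^T *m coord_proj K (~: [set i])) != 0.
Proof.
move=> xw0 b1E; set Y := b2 *m H^T.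
have /cV0Pn[j xj] : x != 0 by apply: contra xw0 => /eqP ->; rewrite mul0mx.
have /rV0Pn[i wi] : w != 0 by apply: contra xw0 => /eqP ->; rewrite mulmx0.
pose z := Y *m w^T.
have xz k l : x k 0 * z l 0 + z k 0 * x l 0 = 0.
  have e : x *m z^T + z *m x^T = 0.
    have -> : z^T = w *m H *m b2^T by rewrite /z /Y !trmx_mul !trmxK mulmxA.
    by rewrite -[RHS]B_iso b1E trmx_mul /z /Y !mulmxA.
  by have /matrixP/(_ k l) := e; rewrite !mxE !big_ord1 !mxE.
have z0 : z = 0.
  have zj : z j 0 = 0.
    have /eqP := xz j j; rewrite mulrC -mulr2n -mulr_natr !mulf_eq0 (negPf two0).
    by rewrite (negPf xj) !orbF => /eqP.
  apply/matrixP => k l; rewrite ord1 [RHS]mxE; have /eqP := xz k j.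
  by rewrite zj mulr0 add0r mulf_eq0 (negPf xj) orbF => /eqP.
exists i; rewrite -unitfE -unitmxE; apply: injective_unitmx => u hu.
have uE : u *m b1 *m coord_proj K [set i] = 0.
  have := congr1 (mulmxr (coord_proj K [set i])) hu.
  rewrite /= mul0mx mulmxDr mulmxDl !mulmxA -[X in X + _]mulmxA coord_projK.
  by rewrite -[X in _ + X]mulmxA coord_proj_orthC mulmx0 addr0.
have uE' : u *m Y *m coord_proj K (~: [set i]) = 0.
  by move: hu; rewrite mulmxDr !mulmxA uE add0r.
have ux : u *m x = 0.
  have /matrixP/(_ 0 i) := uE; rewrite b1E mulmxA [u *m x]mx11_scalar mul_scalar_mx.
  rewrite mul_mx_diag !mxE in_set1 eqxx mulr1 => /eqP; rewrite mulf_eq0 (negPf wi) orbF.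
  by move/eqP => ->; apply/matrixP => ? ?; rewrite !mxE mul0rn.
have uYk k : k != i -> (u *m Y) 0 k = 0.
  move=> ki; have /matrixP/(_ 0 k) := uE'.
  by rewrite mul_mx_diag !mxE !inE ki mulr1.
have uY : u *m Y = 0.
  apply/rowP => k; rewrite [RHS]mxE; have [->|] := eqVneq k i; last exact: uYk.
  have /matrixP/(_ 0 0) : u *m Y *m w^T = 0 by rewrite -mulmxA -/z z0 mulmx0.
  rewrite [X in X = _]mxE (bigD1 i) //= big1 => [|l li]; last by rewrite uYk ?mul0r.
  by rewrite addr0 !mxE => /eqP; rewrite mulf_eq0 (negPf wi) orbF => /eqP.
apply: B_free; first by rewrite b1E mulmxA ux mul0mx.
have HTH : H^T *m H = 1%:M := mulmx1C HK.
by rewrite -[b2]mulmx1 -HTH !mulmxA -(mulmxA u) uY mul0mx.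
Qed.

End LagrangianMove.

(** * Group elements over a field and the move into the chart *)

Section GroupElements.
Variables (K : fieldType) (n : nat) (H : 'M[K]_n) (pi : K).
Hypotheses (two0 : (2%:R : K) != 0) (HT : H^T = - H) (HK : H *m H^T = 1%:M).

Let t : 'M[K]_(n + n) := block_mx 0 1%:M (pi ^+ 2)%:M 0.
Let G : 'M[K]_(n + n) := block_mx 0 H H^T 0.

Definition lattice_aut (g : 'M[K]_(n + n)) : Prop :=
  g *m t = t *m g /\ g *m G *m g^T = G.

Lemma lattice_aut1 : lattice_aut 1%:M.
Proof. by split; rewrite ?trmx1 !mulmx1 !mul1mx. Qed.

Lemma lattice_aut_mul g1 g2 : lattice_aut g1 -> lattice_aut g2 -> lattice_aut (g1 *m g2).
Proof.
move=> [c1 i1] [c2 i2]; split; first by rewrite mulmxA -c1 -!mulmxA c2.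
by rewrite trmx_mul mulmxA -(mulmxA g1) -(mulmxA g1) i2 i1.
Qed.

Lemma lattice_aut_unit g : lattice_aut g -> g \in unitmx.
Proof.
move=> [_ iso]; have GG : G *m G^T = 1%:M.
  rewrite tr_block_mx trmxK !trmx0 mulmx_block !mulmx0 !mul0mx !addr0 !add0r.
  by rewrite HK (mulmx1C HK) -scalar_mx_block.
have : g *m (G *m g^T *m G^T) = 1%:M by rewrite !mulmxA iso GG.
by case/mulmx1_unit.
Qed.

Lemma lattice_aut_inv g : lattice_aut g -> lattice_aut (invmx g).
Proof.
move=> ag; have gu := lattice_aut_unit ag; case: ag => [comm iso]; split.
  apply: (can_inj (mulKmx gu)); rewrite mulmxA mulmxV // mul1mx.
  by rewrite mulmxA comm -mulmxA mulmxV // mulmx1.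
rewrite -{1}iso !mulmxA mulVmx // mul1mx -mulmxA -trmx_mul mulVmx //.
by rewrite trmx1 mulmx1.
Qed.

Lemma lattice_aut_levi T : symplectic H T -> lattice_aut (block_mx T 0 0 T).
Proof.
move=> sT; split.
  rewrite !mulmx_block !mulmx0 !mul0mx !addr0 !add0r mulmx1 mul1mx.
  by rewrite scalar_mxC.
rewrite tr_block_mx !trmx0 !mulmx_block !mulmx0 !mul0mx !addr0 !add0r sT.
have sTT : T *m H^T *m T^T = H^T by rewrite HT mulmxN mulNmx sT.
by rewrite sTT !mul0mx.
Qed.

(** This is 1 + t(WH): skewness of [W] cancels the first-order term of the transformed Gram matrix
    and [W *m H *m W = 0] the second-order one. *)
Lemma lattice_aut_unipotent (W : 'M[K]_n) : W^T = - W -> W *m H *m W = 0 ->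
  lattice_aut (block_mx 1%:M (W *m H) (pi ^+ 2 *: (W *m H)) 1%:M).
Proof.
move=> WT WHW; set E := W *m H.
have EH : E *m H^T = W by rewrite -mulmxA HK mulmx1.
have HE : H *m E^T = - W by rewrite trmx_mul WT !mulmxN mulmxA HK mul1mx.
have EHE : E *m H *m E^T = 0.
  by rewrite -mulmxA HE mulmxN WHW oppr0.
split.
  rewrite !mulmx_block !mulmx0 !mul0mx !addr0 !add0r !mulmx1 !mul1mx.
  by rewrite mul_mx_scalar mul_scalar_mx.
rewrite tr_block_mx !trmx1 trmxZ !mulmx_block !mulmx0 !mulmx1 !mul1mx !addr0 !add0r.
rewrite EH -!scalemxAl -!scalemxAr HE subrr.
rewrite [X in block_mx _ X](_ : _ = H); last first.
  by rewrite -EH HT mulmxN mulNmx EHE oppr0 scaler0 add0r.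
rewrite EHE scaler0 addr0.
have -> : H^T *m E^T = W by rewrite HT mulNmx HE opprK.
have -> : E *m H = - W by rewrite -EH HT mulmxN opprK.
by rewrite scalerN subrr.
Qed.

(** Three moves: [T1] makes the plane [P] general with respect to the isotropic plane [Q0], [h2]
    makes the second block of the Lagrangian invertible, and [T2] makes the plane general with
    respect to [Q] without losing that invertibility. *)
Lemma move_to_chart (b1 b2 : 'M[K]_n) (P : 'M[K]_(2, n)) (X : 'M[K]_(n, 2))
    (J : 'M[K]_2) (Q0 Q : 'M[K]_(n, 2)) :
  (forall x : 'rV_n, x *m b1 = 0 -> x *m b2 = 0 -> x = 0) ->
  b1 *m H *m b2^T + b2 *m H^T *m b1^T = 0 ->
  row_free P -> b1 + pi *: b2 = X *m P -> \rank X <> 1%N ->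
  J^T = - J -> J \in unitmx -> row_free Q0^T -> Q0^T *m H *m Q0 = 0 -> row_free Q^T ->
  exists h, [/\ lattice_aut h, rsubmx (row_mx b1 b2 *m h) \in unitmx
    & rsubmx (row_mx (pi *: P) P *m h) *m Q \in unitmx].
Proof.
move=> B_free B_iso Pf CE rX JT Ju Q0f Q0HQ0 Qf.
have [T1 [sT1 PQ0]] := symplectic_general_position two0 HT HK Pf Q0f.
have T1u := symplectic_unit HK sT1.
set P1 := P *m T1 in PQ0.
have P1f : row_free P1 by rewrite /row_free mxrankMfree // row_free_unit.
have [h2 [P2 [ah2 P2f Bh2 Ph2]]] : exists h2 P2, [/\ lattice_aut h2, row_free P2,
    rsubmx (row_mx (b1 *m T1) (b2 *m T1) *m h2) \in unitmx
    & row_mx (pi *: P1) P1 *m h2 = row_mx (pi *: P2) P2].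
  have triv : b2 *m T1 \in unitmx -> exists h2 P2, [/\ lattice_aut h2, row_free P2,
      rsubmx (row_mx (b1 *m T1) (b2 *m T1) *m h2) \in unitmx
      & row_mx (pi *: P1) P1 *m h2 = row_mx (pi *: P2) P2].
    exists 1%:M, P1; split; rewrite ?mulmx1 ?row_mxKr //; exact: lattice_aut1.
  have free1 (x : 'rV_n) : x *m (b1 *m T1) = 0 -> x *m (b2 *m T1) = 0 -> x = 0.
    rewrite !mulmxA => e1 e2; apply: B_free.
      by rewrite -[LHS](mulmxK T1u) e1 mul0mx.
    by rewrite -[LHS](mulmxK T1u) e2 mul0mx.
  have CE1 : b1 *m T1 + pi *: (b2 *m T1) = X *m P1.
    by rewrite /P1 mulmxA -CE mulmxDl -scalemxAl.
  have [X0|X0] := eqVneq X 0.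
    apply: triv; apply: injective_unitmx => x xb2; apply: free1 => //.
    have -> : b1 *m T1 = - (pi *: (b2 *m T1)).
      by apply/eqP; rewrite -addr_eq0 CE1 X0 mul0mx.
    by rewrite mulmxN -scalemxAr xb2 scaler0 oppr0.
  have Xf : row_free X^T.
    rewrite /row_free mxrank_tr; move: (rank_leq_col X) X0 rX.
    by rewrite -mxrank_eq0; case: (\rank X) => [|[|[|r]]].
  have iso1 : b1 *m T1 *m H *m (b2 *m T1)^T + b2 *m T1 *m H^T *m (b1 *m T1)^T = 0.
    have sT1T : T1 *m H^T *m T1^T = H^T by rewrite HT mulmxN mulNmx sT1.
    rewrite !trmx_mul -!mulmxA !(mulmxA T1) !(mulmxA (T1 *m _)).
    by rewrite sT1 sT1T !mulmxA.
  (* Skew because [J] is, with [W *m H *m W = 0] because [Q0] is isotropic; general position with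
     [Q0] makes [W] nondegenerate on the plane. *)
  pose W := Q0 *m J *m Q0^T.
  have WT : W^T = - W by rewrite !trmx_mul trmxK JT mulNmx mulmxN mulmxA.
  have WHW : W *m H *m W = 0.
    rewrite /W -!mulmxA (mulmxA Q0^T H) (mulmxA (Q0^T *m H)) Q0HQ0.
    by rewrite mul0mx !mulmx0.
  have PWP : P1 *m W *m P1^T \in unitmx.
    have -> : P1 *m W *m P1^T = (P1 *m Q0) *m J *m (P1 *m Q0)^T.
      by rewrite (trmx_mul P1) /W !mulmxA.
    by rewrite !unitmx_mul unitmx_tr PQ0 Ju.
  have [/triv //|uW] := lagrangian_rank2 two0 HT HK free1 iso1 Xf CE1 PWP WHW.
  pose E := W *m H.
  have EE : E *m E = 0 by rewrite /E mulmxA WHW mul0mx.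
  (* On the eigenspace where t is pi, the element 1 + tE acts as 1 + pi E, which gives the new
     plane. *)
  exists (block_mx 1%:M E (pi ^+ 2 *: E) 1%:M), (P1 *m (1%:M + pi *: E)); split.
  - exact: lattice_aut_unipotent.
  - rewrite /row_free mxrankMfree // row_free_unit.
    have : (1%:M + pi *: E) *m (1%:M - pi *: E) = 1%:M.
      rewrite mulmxBr mulmx1 mulmxDl mul1mx -scalemxAl -scalemxAr EE !scaler0 addr0.
      by rewrite addrK.
    by case/mulmx1_unit.
  - by rewrite mul_row_block row_mxKr mulmx1 addrC.
  - rewrite mul_row_block !mulmx1 mulmxDr mulmx1 -!scalemxAr -scalemxAl; congr row_mx.
      by rewrite scalerDr scalerA expr2.
    by rewrite addrC.
have [T2 [sT2 PQ]] := symplectic_general_position two0 HT HK P2f Qf.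
exists (block_mx T1 0 0 T1 *m h2 *m block_mx T2 0 0 T2); split.
- by do 2?[apply: lattice_aut_mul] => //; apply: lattice_aut_levi.
- rewrite !mulmxA mul_row_block !mulmx0 addr0 add0r.
  set M := _ *m h2 in Bh2 *.
  rewrite -[M]hsubmxK mul_row_block !mulmx0 add0r row_mxKr unitmx_mul Bh2 /=.
  exact: (symplectic_unit HK sT2).
- rewrite !mulmxA mul_row_block !mulmx0 addr0 add0r -scalemxAl -/P1 Ph2.
  by rewrite mul_row_block !mulmx0 add0r row_mxKr.
Qed.

End GroupElements.

(** * Submodules and coordinates over a field *)

Section FieldSubmodules.
Variables (K : fieldType) (N : nat).

Lemma submod_mulmx (M : submod K N) k (c : 'rV[K]_k) (A : 'M[K]_(k, N)) :
  is_submod M -> (forall i, M (row i A)) -> M (c *m A).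
Proof.
move=> [M0 MD] hA; rewrite mulmx_sum_row; apply: (big_ind M) => // [x y hx hy|i _].
  by have := MD 1 x y hx hy; rewrite scale1r.
by have := MD (c 0 i) (row i A) 0 (hA i) M0; rewrite addr0.
Qed.

Lemma base_change_id (M : submod K N) w :
  is_submod M -> base_change idfun M w <-> M w.
Proof.
move=> subM; split=> [[k [A [c [hA ->]]]]|Mw].
  by rewrite map_mx_id //; apply: submod_mulmx.
exists 1%N, w, (1%:M : 'M_1); split=> [i|]; last by rewrite map_mx_id // mul1mx.
by rewrite (_ : row i w = w) //; apply/rowP => j; rewrite !mxE ord1.
Qed.

Lemma local_summand_basis d (M : submod K N) : local_summand d M ->
  exists (B : 'M[K]_(d, N)) (C : 'M[K]_(N, d)),
    (forall w, M w <-> exists c : 'rV_d, w = c *m B) /\ B *m C = 1%:M.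
Proof.
move=> [subM [k [g [a [ga free]]]]].
have [i gi] : exists i, g i != 0.
  apply/existsP; rewrite -negb_forall; apply/negP => /forallP g0.
  move/eqP: ga; rewrite big1 ?(eq_sym 0) ?oner_eq0 // => i _.
  by have /eqP -> := g0 i; rewrite mulr0.
have [|B [C [[MB _] BC]]] := free i K idfun; first by exists (g i)^-1; rewrite /= mulfV.
exists B, C; split=> // w; rewrite -MB; split=> [Mw|Mw]; exact/base_change_id.
Qed.

Lemma basis_local_summand d (M : submod K N) (B : 'M[K]_(d, N)) (C : 'M[K]_(N, d)) :
  (forall w, M w <-> exists c : 'rV_d, w = c *m B) -> B *m C = 1%:M ->
  local_summand d M.
Proof.
move=> MB BC; split.
  split; first by apply/MB; exists 0; rewrite mul0mx.
  move=> c x y /MB[c1 ->] /MB[c2 ->]; apply/MB; exists (c *: c1 + c2).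
  by rewrite mulmxDl scalemxAl.
exists 1%N, (fun=> 1), (fun=> 1); split; first by rewrite big_ord1 mulr1.
move=> _ S f _; exists (map_mx f B), (map_mx f C); split; last first.
  by rewrite -map_mxM BC map_mx1.
split=> [w|c cB].
  split=> [[k [A [c [hA ->]]]]|[c ->]].
    have rows i : exists c' : 'rV_d, row i A = c' *m B by exact/MB.
    have [c' hc'] := choice rows.
    have -> : A = (\matrix_i c' i) *m B.
      by apply/row_matrixP => i; rewrite row_mul rowK hc'.
    by exists (c *m map_mx f (\matrix_i c' i)); rewrite map_mxM mulmxA.
  exists d, B, c; split=> // i; apply/MB; exists (delta_mx 0 i); exact: rowE.
by rewrite -[c]mulmx1 -(map_mx1 f) -BC map_mxM mulmxA cB mul0mx.
Qed.

End FieldSubmodules.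

Section Chart.
Variables (K : fieldType) (n : nat).

Definition coord_pair (i1 i2 : 'I_n) : 'M[K]_(n, 2) :=
  \matrix_(i, j) (i == if j == 0 then i1 else i2)%:R.

Lemma mul_coord_pair q (A : 'M[K]_(q, n)) i1 i2 i j :
  (A *m coord_pair i1 i2) i j = A i (if j == 0 then i1 else i2).
Proof.
rewrite mxE (bigD1 (if j == 0 then i1 else i2)) //= big1 => [|k ki].
  by rewrite mxE eqxx mulr1 addr0.
by rewrite mxE (negPf ki) mulr0.
Qed.

Lemma coord_pair_free i1 i2 : i1 != i2 -> row_free (coord_pair i1 i2)^T.
Proof.
move=> i12; apply/row_freeP; exists (coord_pair i1 i2); apply/matrixP => i j.
rewrite mul_coord_pair !mxE.
case: (ord2P i) (ord2P j) => -> [] ->; rewrite ?eqxx //= ?(negPf i12) //.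
by rewrite eq_sym (negPf i12).
Qed.

End Chart.

(** The partners of the first two indices under [rev_ord] are the last two, which differ from them
    as soon as m > 1. *)
Lemma sign_mx_isotropic (R : comNzRingType) m (j0 j1 : 'I_(2 * m)) :
  (1 < m)%N -> val j0 = 0%N -> val j1 = 1%N ->
  forall i j : 'I_(2 * m), (i \in [:: j0; j1]) -> (j \in [:: j0; j1]) ->
  sign_mx m R i j = 0.
Proof.
move=> m1 e0 e1 i j hi hj; rewrite mxE ifN //; apply/eqP => /(congr1 val) /=.
by move: hi hj; rewrite !inE => /orP[]/eqP-> /orP[]/eqP->; rewrite ?e0 ?e1; lia.
Qed.

(** * Moving a point of the splitting model into the chart *)

Theorem theorem5p4 (D : ramified_quadratic) (m : nat) (hn : (3 < 2 * m)%N)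
    (i1 i2 : 'I_(2 * m)) (hi : i1 != i2) :
  translates_cover (@chart D m i1 i2) (@Mspl D m (2 * m - 2)%N 2%N).
Proof.
move=> K a M0 M1 [[[sub01 lin0 lin1] perp tM1 tM0] loc].
have m1 : (1 < m)%N by lia.
set b : {rmorphism OF0 D -> K} := a \o @OF0_OF D in perp tM1 tM0.
set pi := a (piO D) in tM1 tM0.
have pi2 : b (piO0 D) = pi ^+ 2.
  by rewrite -rmorphXn; congr (a _); apply: val_inj; rewrite /= -rq_pi_sqr.
have two0 : (2%:R : K) != 0.
  have [h h2] := OF0_half D; apply/eqP => two.
  have := congr1 b h2; rewrite rmorphMn rmorph1 /= -mulr_natr two mulr0 => /eqP.
  by rewrite eq_sym oner_eq0.
pose H := sign_mx m K; have HT : H^T = - H := tr_sign_mx m K.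
have HK : H *m H^T = 1%:M := sign_mxK m K.
have tE : tR m b = block_mx 0 1%:M (pi ^+ 2)%:M 0 by rewrite tR_blocks pi2.
have GE : map_mx b (gram D m) = block_mx 0 H H^T 0 := gram_map m b.
have [B [C [MB BC]]] := local_summand_basis lin1.
have [B0 [C0 [MB0 BC0]]] := local_summand_basis lin0.
have MBrow i : M1 (row i B) by apply/MB; exists (delta_mx 0 i); rewrite rowE.
have MB0row i : M0 (row i B0) by apply/MB0; exists (delta_mx 0 i); rewrite rowE.
pose b1 := lsubmx B; pose b2 := rsubmx B.
have BE : B = row_mx b1 b2 by rewrite hsubmxK.
have B_free (x : 'rV_(2 * m)) : x *m b1 = 0 -> x *m b2 = 0 -> x = 0.
  move=> x1 x2; rewrite -[x]mulmx1 -BC mulmxA {1}BE mul_mx_row x1 x2.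
  by rewrite row_mx0 mul0mx.
have B_iso : b1 *m H *m b2^T + b2 *m H^T *m b1^T = 0.
  have : B *m map_mx b (gram D m) *m B^T = 0.
    by apply: pairing_rows => i j; exact: (proj1 (perp _) (MBrow i) _ (MBrow j)).
  rewrite GE {1}BE mul_row_block !mulmx0 add0r addr0 BE tr_row_mx mul_row_col.
  by rewrite addrC.
pose P := rsubmx B0.
(* The rows of [B0] are eigenvectors of t for pi, which gives the shape [(pi P | P)] of F_0. *)
have B0t : B0 *m tR m b = pi *: B0.
  apply/row_matrixP => i; rewrite row_mul linearZ /=; apply/eqP.
  by rewrite -subr_eq0; apply/eqP/tM0.
have B0E : B0 = row_mx (pi *: P) P.
  rewrite -[LHS]hsubmxK; congr row_mx.
  move: B0t; rewrite tE -{1}[B0]hsubmxK mul_row_block !mulmx0 mulmx1 add0r addr0.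
  by rewrite -{3}[B0]hsubmxK scale_row_mx => /eq_row_mx[_ ->].
have Pf : row_free P.
  apply/row_freeP; exists (pi *: usubmx C0 + dsubmx C0).
  rewrite -BC0 B0E -[C0 in RHS]vsubmxK mul_row_col mulmxDr.
  by rewrite -scalemxAl -scalemxAr.
(* [X] expresses the inclusion of (t + pi) F_1 in F_0 in the chosen bases. *)
have [X BX] : exists X : 'M_(2 * m, 2), B *m tR m b + pi *: B = X *m B0.
  have rows i : exists c : 'rV_2, row i (B *m tR m b + pi *: B) = c *m B0.
    by apply/MB0; rewrite linearD linearZ /= row_mul; apply: tM1.
  have [c hc] := choice rows.
  by exists (\matrix_i c i); apply/row_matrixP => i; rewrite [RHS]row_mul rowK hc.
have CE : b1 + pi *: b2 = X *m P.
  move: BX; rewrite tE BE B0E mul_row_block !mulmx0 mulmx1 add0r addr0.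
  by rewrite scale_row_mx add_row_mx mul_mx_row => /eq_row_mx[_ ->].
have rX : \rank X <> 1%N.
  move=> rX.
  (* Writing the basis of F_0 in that of F_1 gives [Y *m X = 2 pi], so a nonzero pi would force rank
     2. *)
  have pi0 : pi = 0.
    have [Y BY] : exists Y : 'M_(2, 2 * m), B0 = Y *m B.
      have rows i : exists c : 'rV_(2 * m), row i B0 = c *m B by apply/MB/sub01.
      have [c hc] := choice rows.
      by exists (\matrix_i c i); apply/row_matrixP => i; rewrite row_mul rowK hc.
    have YX : Y *m X = (pi *+ 2)%:M.
      rewrite -[LHS]mulmx1 -BC0 mulmxA -(mulmxA Y) -BX mulmxDr mulmxA -scalemxAr -BY.
      by rewrite B0t -scalerDl -scalemxAl BC0 -mulr2n scalemx1.
    apply/eqP/negPn/negP => pi_neq0.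
    have : \rank (Y *m X) = 2%N.
      apply: mxrank_unit; rewrite YX -scalemx1 unitmxZ ?unitmx1 //.
      by rewrite unitfE -mulr_natr mulf_neq0.
    by move: (mxrankM_maxr Y X); rewrite rX => + e; rewrite e.
  have b1E : b1 = X *m P by rewrite -CE pi0 scale0r addr0.
  have [x [y Xxy]] : exists (x : 'cV_(2 * m)) (y : 'rV_2), X = x *m y.
    rewrite -(mulmx_base X); move: (col_base X) (row_base X); rewrite rX => x y.
    by exists x, y.
  have xyP : x *m (y *m P) != 0.
    by rewrite mulmxA -Xxy -mxrank_eq0 mxrankMfree // rX.
  (* The nonzero determinant found here contradicts the spin condition, evaluated on the rows of
     [B]. *)
  have [|i] := lagrangian_rank1 two0 HK B_free B_iso xyP.
    by rewrite b1E Xxy mulmxA.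
  have := spin_condition_Mloc (ltnW m1) loc MBrow i.
  by rewrite BE mul_row_col mulmxA => ->; rewrite eqxx.
have lt0 : (0 < 2 * m)%N by lia.
have lt1 : (1 < 2 * m)%N by lia.
pose j0 := Ordinal lt0; pose j1 := Ordinal lt1.
have Q0f : row_free (coord_pair K j0 j1)^T by apply: coord_pair_free.
have Q0HQ0 : (coord_pair K j0 j1)^T *m H *m coord_pair K j0 j1 = 0.
  apply/matrixP => i j; rewrite mul_coord_pair -[H]trmxK -trmx_mul mxE.
  rewrite mul_coord_pair mxE [RHS]mxE; apply: (@sign_mx_isotropic K m j0 j1) => //.
    by case: ifP; rewrite !inE eqxx ?orbT.
  by case: ifP; rewrite !inE eqxx ?orbT.
(* The invertible skew matrix [J] is [sign_mx 1 K], and [Q0] is the isotropic plane of the first two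
   coordinates. *)
have [h [ah hB hP]] := move_to_chart two0 HT HK B_free B_iso Pf CE rX
  (tr_sign_mx 1 K) (proj1 (mulmx1_unit (sign_mxK 1 K))) Q0f Q0HQ0
  (coord_pair_free K hi).
rewrite -B0E in hP; rewrite -BE in hB.
have hu := lattice_aut_unit HK ah.
pose g := invmx h; have [gt gG] : lattice_aut H pi g := lattice_aut_inv HK ah.
rewrite -tE in gt; rewrite -GE in gG.
have gu : g \in unitmx by rewrite unitmx_inv.
have UE d (M : submod K _) (A : 'M_(d, _)) :
    (forall w, M w <-> exists c : 'rV_d, w = c *m A) ->
    forall w, M (w *m g) <-> exists c : 'rV_d, w = c *m (A *m h).
  move=> MA w; rewrite MA; split=> -[c e]; exists c.
    by rewrite mulmxA -e mulmxKV.
  by rewrite e mulmxA mulmxK.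
have U1E := UE _ _ _ MB; have U0E := UE _ _ _ MB0.
(* The chart point is the image of the given one under [h], so its translate by [g] is the given
   point. In the bases pi^k f_j one matrix serves at every level of the chain. *)
exists K, a, idfun, (fun=> g), (fun w => M0 (w *m g)), (fun w => M1 (w *m g)).
split=> //.
- split=> //; first by move=> _; exists h; rewrite mulmxV ?mulVmx.
  by exists 1; [exists 1; rewrite mulr1|move=> _; rewrite scale1r].
- split.
  + split.
    * split; first by move=> w; apply: sub01.
        apply: (basis_local_summand (C := g *m C0) U0E).
        by rewrite -mulmxA (mulmxA h) mulmxV // mul1mx.
      apply: (basis_local_summand (C := g *m C) U1E).
      by rewrite -mulmxA (mulmxA h) mulmxV // mul1mx.
    * have pairE w w' : pairing b (w *m g) (w' *m g) = pairing b w w'.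
        by rewrite /pairing trmx_mul -[in RHS]gG !mulmxA.
      move=> w; rewrite perp; split=> [hw w' Mw'|hw w' Mw'].
        by rewrite -pairE; apply: hw.
      by rewrite -[w'](mulmxKV gu) pairE; apply: hw; rewrite mulmxKV.
    * move=> w /tM1; rewrite -mulmxA -/b gt => Mw.
      by rewrite mulmxDl -scalemxAl -mulmxA.
    * move=> w /tM0; rewrite -/b -/pi -mulmxA gt mulmxA scalemxAl -mulmxBl => e.
      by rewrite -[LHS](mulmxK gu) e mul0mx.
  + move=> y; exists (y *m invmx (rsubmx (B *m h)) *m (B *m h)).
    have rE k (c : 'M_(k, _)) (A : 'M[K]_(_, _ + _)) : rsubmx (c *m A) = c *m rsubmx A.
      by rewrite -{1}[A]hsubmxK mul_mx_row row_mxKr.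
    set A := B *m h in hB U1E *.
    split; first by split; [apply/U1E; eexists|rewrite (rE _ _ _ _ _ A) mulmxKV].
    by move=> _ [/U1E[c ->] <-]; rewrite (rE _ _ _ _ _ A) mulmxK.
  + move=> y1 y2; set N := rsubmx (B0 *m h) *m _ in hP.
    pose y : 'rV[K]_2 := \row_j if j == 0 then y1 else y2.
    have NE (c : 'rV_2) : (c *m (B0 *m h)) 0 (rshift _ i1) = y1 /\
        (c *m (B0 *m h)) 0 (rshift _ i2) = y2 <-> c *m N = y.
      have NjE j : (c *m N) 0 j =
          (c *m (B0 *m h)) 0 (rshift _ (if j == 0 then i1 else i2)).
        rewrite /N mulmxA mul_coord_pair -{2}[B0 *m h]hsubmxK mul_mx_row.
        by rewrite row_mxEr.
      split=> [[e1 e2]|e].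
        by apply/rowP => j; rewrite NjE [RHS]mxE; case: ifP.
      have := NjE 0; have := NjE 1.
      by rewrite e [y 0 0]mxE [y 0 1]mxE /= => <- <-.
    exists (y *m invmx N *m (B0 *m h)); split.
      by split; [apply/U0E; eexists|apply/NE; rewrite mulmxKV].
    by move=> _ [/U0E[c ->] /NE <-]; rewrite mulmxK.
- move=> w; rewrite base_change_id; last by case: lin0.
  split=> [Mw|[x Mx ->] //]; exists (w *m h); rewrite mulmxK //.
- move=> w; rewrite base_change_id; last by case: lin1.
  split=> [Mw|[x Mx ->] //]; exists (w *m h); rewrite mulmxK //.
Qed.
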